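(* Let $(M,g)$ be an asymptotically flat $3$-manifold with or without boundary. Let $E$ be an end of $(M,g)$ on which $g$ is asymptotically Schwarzschild with nonzero mass, i.e. there are a constant $m\neq 0$ and a coordinate chart $\{x_1,x_2,x_3\}$ on $E$ near infinity in which $g_{ij}=\left(1+\frac{m}{2|x|}\right)^4\delta_{ij}+p_{ij}$ with $p_{ij}=O_2(|x|^{-2})$. Then any static potential $f$ on $E$ is bounded and is either positive outside a compact set or negative outside a compact set.
   Context: Static potential: a nontrivial (not identically zero) smooth function $f$ satisfying $-(\Delta f)g+\nabla^2 f-f\,\mathrm{Ric}=0$, where $\nabla^2$, $\Delta$, $\mathrm{Ric}$ are the Hessian, Laplacian and Ricci curvature of $g$. (On an asymptotically flat manifold the existence of a static potential forces the scalar curvature to be zero, and the equation becomes $\nabla^2 f=f\,\mathrm{Ric}$, $\Delta f=0$.) Notation: $\phi=O_l(|x|^{-\tau})$ means $|\partial^i\phi|\le C|x|^{-\tau-i}$ for $0\le i\le l$ and some constant $C$. Asymptotically flat: a Riemannian $3$-manifold $(M,g)$ (perhaps with boundary) is asymptotically flat if there is a compact set $K$ such that $M\setminus K$ has finitely many components $E_1,\dots,E_k$, called the ends, each diffeomorphic to $\mathbb{R}^3$ minus a ball, and under this diffeomorphism the metric on $E_i$ satisfies $g_{ij}=\delta_{ij}+b_{ij}$ with $b_{ij}=O_2(|x|^{-\tau})$ for some constant $\tau>\frac12$, where $x=(x_1,x_2,x_3)$ are the standard coordinates on $\mathbb{R}^3$. The constant $m$ in the asymptotically Schwarzschild expansion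 equals the ADM mass of $(M,g)$ at the end $E$.
   Formalization: Since the end may be open at the removed ball, where f can blow up or change sign, boundedness is claimed on {|x| ≥ r} for every r larger than the ball's radius, and ''outside a compact set'' means outside a compact set of R^3 in the coordinates of the end. *)

(* Defs.v *)
From HB Require Import structures.
From mathcomp Require Import all_boot all_order all_algebra.
From mathcomp Require Import all_classical all_reals all_analysis.
Set Implicit Arguments.
Unset Strict Implicit.
Unset Printing Implicit Defensive.
Import Order.TTheory GRing.Theory Num.Theory.
Import numFieldNormedType.Exports.
Local Open Scope classical_set_scope.
Local Open Scope ring_scope.

Section Euclidean.
Context {R : realType}.
Notation V := 'rV[R]_3.

(* The library norm on row vectors is the sup norm. *)
Definition enorm (x : V) : R := Num.sqrt (\sum_(a < 3) x 0 a ^+ 2).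

Definition exterior (r : R) : set V := [set x | r < enorm x].

Definition half_space : set V := [set x | 0 <= x 0 0].

Definition partial (a : 'I_3) (F : V -> R) : V -> R :=
  fun x => 'D_(delta_mx 0 a) F x.

Definition partials (s : seq 'I_3) (F : V -> R) : V -> R := foldr partial F s.

Definition smooth_on_open (U : set V) (F : V -> R) : Prop :=
  forall (s : seq 'I_3) (x : V), U x ->
    {for x, continuous (partials s F)} /\
    forall a : 'I_3, derivable (partials s F) x (delta_mx 0 a).

(* On a set A that need not be open (a piece of a half-space), smoothness
   means local extendability to a smooth function on an open set; when A is
   open this is the same as smooth_on_open A F. *)
Definition smooth_on (A : set V) (F : V -> R) : Prop :=
  forall x, A x -> exists U : set V, exists G : V -> R,
    [/\ open U, U x, smooth_on_open U G & {in A `&` U, F =1 G}].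

(* F = O_l(|x|^(-tau)) on {|x| > r}; a partial derivative of order i is
   \partial_s F with s a list of i indices. *)
Definition bigO_deriv (l : nat) (tau r : R) (F : V -> R) : Prop :=
  exists C : R, forall (s : seq 'I_3) (x : V),
    (size s <= l)%N -> exterior r x ->
    `|partials s F x| <= C * enorm x `^ (- tau - (size s)%:R).

Definition jacobian_mx (phi : V -> V) (x : V) : 'M[R]_3 :=
  \matrix_(a, b) partial b (fun y => phi y 0 a) x.

Section CoordinateGeometry.
Variable g : V -> 'M[R]_3.

Definition christoffel (c a b : 'I_3) (x : V) : R :=
  2^-1 * \sum_(d < 3) invmx (g x) c d *
    (partial a (fun y => g y b d) x + partial b (fun y => g y a d) x
     - partial d (fun y => g y a b) x).

Definition ricci (a b : 'I_3) (x : V) : R :=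
  \sum_(c < 3) (partial c (christoffel c a b) x
                - partial b (christoffel c a c) x)
  + \sum_(c < 3) \sum_(d < 3)
      (christoffel c c d x * christoffel d a b x
       - christoffel c b d x * christoffel d a c x).

Definition hessian (F : V -> R) (a b : 'I_3) (x : V) : R :=
  partials [:: a; b] F x - \sum_(c < 3) christoffel c a b x * partial c F x.

Definition laplacian (F : V -> R) (x : V) : R :=
  \sum_(a < 3) \sum_(b < 3) invmx (g x) a b * hessian F a b x.

Definition static_equation_at (F : V -> R) (x : V) : Prop :=
  forall a b : 'I_3,
    - laplacian F x * g x a b + hessian F a b x - F x * ricci a b x = 0.

End CoordinateGeometry.
End Euclidean.

Section Manifolds.
Variables (R : realType) (M : topologicalType).
Notation V := 'rV[R]_3.

(* Only the values of cmap on cdom and of cinv on cmap @` cdom matter. *)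
Record chart := Chart { cdom : set M; cmap : M -> V; cinv : V -> M }.

Definition cimage (c : chart) : set V := cmap c @` cdom c.

(* Interior charts have an image open in R^3, boundary charts an image
   relatively open in the half-space. *)
Definition is_chart (c : chart) : Prop :=
  [/\ open (cdom c),
      (exists2 U : set V, open U & cimage c = U \/ cimage c = U `&` half_space),
      (forall p, cdom c p -> cinv c (cmap c p) = p),
      {within cdom c, continuous (cmap c)} &
      {within cimage c, continuous (cinv c)}].

Definition change (c d : chart) : V -> V := fun x => cmap d (cinv c x).

Definition smooth_change (c d : chart) : Prop :=
  forall a : 'I_3,
    smooth_on (cmap c @` (cdom c `&` cdom d)) (fun x => change c d x 0 a).

Definition compatible (c d : chart) : Prop :=
  smooth_change c d /\ smooth_change d c.

(* Smooth 3-manifolds, possibly with boundary. *)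
Record smooth_structure := SmoothStructure {
  manifold_hausdorff : hausdorff_space M;
  manifold_second_countable : @second_countable M;
  atlas : set chart;
  atlas_chart : forall c, atlas c -> is_chart c;
  atlas_cover : forall p, exists2 c, atlas c & cdom c p;
  atlas_compatible : forall c d, atlas c -> atlas d -> compatible c d }.

Definition max_atlas (S : smooth_structure) : set chart :=
  [set c | is_chart c /\ forall d, atlas S d -> compatible c d].

(* A metric is given by its component matrices in all charts of the maximal
   atlas.  The tensor law is imposed at interior points of the overlap, where
   partial derivatives make sense; it extends to the boundary by continuity. *)
Record riemannian_metric (S : smooth_structure) := RiemannianMetric {
  gcoef : chart -> V -> 'M[R]_3;
  gcoef_smooth : forall c, max_atlas S c -> forall a b : 'I_3,
    smooth_on (cimage c) (fun x => gcoef c x a b);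
  gcoef_sym : forall c, max_atlas S c -> forall x, cimage c x ->
    (gcoef c x)^T = gcoef c x;
  gcoef_pos : forall c, max_atlas S c -> forall x, cimage c x ->
    forall v : V, v != 0 -> 0 < (v *m gcoef c x *m v^T) 0 0;
  gcoef_change : forall c d, max_atlas S c -> max_atlas S d ->
    forall x, (cmap c @` (cdom c `&` cdom d))° x ->
    gcoef c x = (jacobian_mx (change c d) x)^T *m gcoef d (change c d x)
                *m jacobian_mx (change c d) x }.

(* f : M -> R is only constrained on the open set E. *)
Definition static_potential (S : smooth_structure) (g : riemannian_metric S)
    (E : set M) (f : M -> R) : Prop :=
  [/\ (forall c, max_atlas S c ->
         smooth_on (cmap c @` (cdom c `&` E)) (f \o cinv c)),
      (exists2 p, E p & f p != 0) &
      (forall c, max_atlas S c -> forall x, (cmap c @` (cdom c `&` E))° x ->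
         static_equation_at (gcoef g c) (f \o cinv c) x)].

(* A component E of M \ K is open in M, so the ball that is removed from R^3
   is a closed one, {|x| <= radius}. *)
Record asymptotically_flat (S : smooth_structure) (g : riemannian_metric S) :=
  AsymptoticallyFlat {
  core : set M;
  core_compact : compact core;
  nends : nat;
  end_chart : 'I_nends -> chart;
  end_radius : 'I_nends -> R;
  end_order : 'I_nends -> R;
  ends_cover : ~` core = \bigcup_(i in [set: 'I_nends]) cdom (end_chart i);
  ends_component : forall i p, cdom (end_chart i) p ->
    cdom (end_chart i) = connected_component (~` core) p;
  ends_distinct : forall i j, cdom (end_chart i) = cdom (end_chart j) -> i = j;
  end_chart_max : forall i, max_atlas S (end_chart i);
  end_radius_gt0 : forall i, 0 < end_radius i;
  end_chart_image : forall i, cimage (end_chart i) = exterior (end_radius i);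
  end_order_gt : forall i, 2^-1 < end_order i;
  end_metric : forall i (a b : 'I_3),
    bigO_deriv 2 (end_order i) (end_radius i)
      (fun x => gcoef g (end_chart i) x a b - (a == b)%:R) }.

Section End.
Variables (S : smooth_structure) (g : riemannian_metric S).
Variables (A : asymptotically_flat g) (i : 'I_(nends A)).

Definition the_end : set M := cdom (end_chart i).

Definition end_norm (p : M) : R := enorm (cmap (end_chart i) p).

(* psi need not be the chart of the end in A: it only has to be a chart of the
   manifold, defined on E near infinity, with |psi| -> oo at infinity in E. *)
Definition chart_near_infinity (psi : chart) (r : R) : Prop :=
  [/\ max_atlas S psi, cdom psi `<=` the_end, 0 < r,
      cimage psi = exterior r &
      forall s : R, exists t : R, forall p, the_end p -> t < end_norm p ->
        cdom psi p /\ s < enorm (cmap psi p)].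

Definition asymptotically_schwarzschild (m : R) : Prop :=
  exists psi : chart, exists2 r : R, chart_near_infinity psi r &
    forall a b : 'I_3, bigO_deriv 2 2 r (fun x =>
      gcoef g psi x a b - (1 + m / (2 * enorm x)) ^+ 4 * (a == b)%:R).

(* E is identified with R^3 minus a closed ball by the chart of the end.
   Boundedness on E is boundedness up to, but not at, the removed ball: the
   definition of asymptotic flatness does not control g and f there.  For
   instance the metric (1 + m/(2|x|))^4 delta with m < 0 on {|x| > -m/2} has
   the static potential (1 - m/(2|x|)) / (1 + m/(2|x|)), which blows up at the
   removed ball. *)
Definition bounded_on_end (f : M -> R) : Prop :=
  forall r : R, end_radius i < r -> exists C : R,
    forall p, the_end p -> r <= end_norm p -> `|f p| <= C.

(* "Outside a compact set" refers to compact sets of R^3, for the same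
   reason: the definition does not make the removed ball's vicinity
   relatively compact in M. *)
Definition outside_compact (P : M -> Prop) : Prop :=
  exists2 C : set V, compact C &
    forall p, the_end p -> ~ C (cmap (end_chart i) p) -> P p.

End End.
End Manifolds.

(* Main.v *)
(** The trace of the static equation turns it into the linear system
    [Hess f = (Ric - R/2 g) f], so the scalar curvature need not be known to
    vanish.  In a Schwarzschild chart the system reads
    [d_i d_j f = O(|x|^-2) df + O(|x|^-3) f].  An energy estimate along rays gives
    [df = O(|x|^(1/2))], hence [df = a + O(|x|^(-1/2))] for a constant vector [a].
    Inserting [f ~ a.x] into the leading terms of the system, which are
    proportional to [m], prescribes a Hessian that is not closed unless [m a = 0]:
    following [d_j f] from infinity down two diagonal rays, or along the segment
    joining their points, gives opposite signs.  So [a = 0], then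
    [df = O(|x|^(-3/2))] and [f] tends to a constant [b].  If [b <> 0] we are done.
    If [b = 0], the system integrated from infinity is a contraction, so [f]
    vanishes near infinity, hence on the whole end by Gronwall along rays. *)

Require Import Defs.
From mathcomp Require Import all_boot all_order all_algebra.
From mathcomp Require Import all_classical all_reals all_analysis.
From mathcomp Require Import ring lra.
Import Order.TTheory GRing.Theory Num.Theory.
Import numFieldNormedType.Exports.
Local Open Scope classical_set_scope.
Local Open Scope ring_scope.
Set Implicit Arguments.
Unset Strict Implicit.
Unset Printing Implicit Defensive.


(** * Directional derivatives *)

(** All that matters in the energy estimate is that df grows strictly slower than |x|, so that the
    Hessian is integrable at infinity; the exponent 1/2 is a convenient value. The obstruction rests
    on a gap of half a power: once df tends to [a], the system fixes the Hessian up to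
    O(|x|^(-5/2)), while the leading part, linear in [m] and in [a], has size |x|^(-2). Pairs of
    points that differ by the sign of one coordinate x_i are compared, because the other component
    of [a] then cancels and the remaining sign is that of a multiple of (m a_i)^2. Two charts of the
    end are in play. The asymptotics are known only in the Schwarzschild chart, whereas f is nonzero
    at some point of the whole end, possibly outside that chart. Hence unique continuation is
    carried out in the chart of the end, with coefficients bounded only on compact annuli. The
    charts are linked only by the fact that points far out in the chart of the end lie far out in
    the Schwarzschild chart. *)

Section DirectionalDerivatives.
Context {R : realType} {V : normedModType R}.
Implicit Types (F G : V -> R) (x v : V).

Lemma is_derive_cvg F x v (l : R) :
  h^-1 *: (F (h *: v + x) - F x) @[h --> 0^'] --> l -> is_derive x v F l.
Proof.
move=> Fl; apply: DeriveDef; last exact: cvg_lim Fl.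
by apply/cvg_ex; exists l.
Qed.

Lemma is_derive_fD F G x v (a b : R) : is_derive x v F a -> is_derive x v G b ->
  is_derive x v (fun y => F y + G y) (a + b).
Proof. by move=> Fa Gb; exact: is_deriveD. Qed.

Lemma is_derive_fB F G x v (a b : R) : is_derive x v F a -> is_derive x v G b ->
  is_derive x v (fun y => F y - G y) (a - b).
Proof. by move=> Fa Gb; exact: is_deriveB. Qed.

Lemma is_derive_fM F G x v (a b : R) : is_derive x v F a -> is_derive x v G b ->
  is_derive x v (fun y => F y * G y) (a * G x + F x * b).
Proof.
move=> Fa Gb; apply: (@is_derive_eq _ _ _ (F * G)).
by rewrite /GRing.scale /= addrC mulrC.
Qed.

Lemma is_derive_fZ F x v (c a : R) : is_derive x v F a ->
  is_derive x v (fun y => c * F y) (c * a).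
Proof. by move=> Fa; exact: is_deriveZ. Qed.

Lemma is_derive_fsum (I : Type) (r : seq I) (P : pred I) (F : I -> V -> R) x v
    (d : I -> R) : (forall i, is_derive x v (F i) (d i)) ->
  is_derive x v (fun y => \sum_(i <- r | P i) F i y) (\sum_(i <- r | P i) d i).
Proof.
move=> Fd; elim: r => [|i r IH].
  rewrite big_nil; under eq_fun do rewrite big_nil.
  exact: is_derive_cst.
rewrite big_cons; under eq_fun do rewrite big_cons.
by case: (P i) => //; exact: is_derive_fD.
Qed.

Lemma is_derive_line F x v (t d : R) : is_derive (x + t *: v) v F d ->
  is_derive t 1 (fun s => F (x + s *: v)) d.
Proof.
move=> [dF eF].
have E : (fun h : R => h^-1 *: (((fun s => F (x + s *: v)) \o shift t) (h *: 1)
     - F (x + t *: v))) =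
   (fun h : R => h^-1 *: ((F \o shift (x + t *: v)) (h *: v) - F (x + t *: v))).
  apply/funext => h /=; congr (_ *: (F _ - _)).
  by rewrite [h%:A]mulr1 scalerDl addrCA.
by apply: DeriveDef; [rewrite /derivable E|rewrite /derive E].
Qed.

(** [F] is only known to have a derivative in the direction [v], so the chain rule is applied to its
    restriction to the line through [x], a function of one variable. *)
Lemma is_derive_comp1 F x v (h : R -> R) (d dh : R) :
  is_derive x v F d -> is_derive (F x) 1 h dh ->
  is_derive x v (fun y => h (F y)) (dh * d).
Proof.
move=> dF hF.
have dl : is_derive (0 : R) 1 (fun s => F (x + s *: v)) d.
  by apply: is_derive_line; rewrite scale0r addr0.
have dh0 : is_derive (F (x + 0 *: v)) 1 h dh by rewrite scale0r addr0.
pose l := fun s : R => F (x + s *: v).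
have dc : is_derive (0 : R) 1 (h \o l) (dh * d).
  apply: DeriveDef.
    apply/derivable1_diffP/differentiable_comp; apply/derivable1_diffP; first by case: dl.
    by case: dh0.
  rewrite -derive1E derive1_comp; [|by case: dl|by case: dh0].
  rewrite !derive1E; congr (_ * _); first by case: dh0.
  by case: dl.
apply: is_derive_cvg.
have E : (fun k : R => k^-1 *: ((h \o l) (k *: 1 + 0) - (h \o l) 0)) =
   (fun k : R => k^-1 *: (h (F (k *: v + x)) - h (F x))).
  apply/funext => k /=; rewrite /l [_%:A]mulr1 addr0 scale0r addr0.
  by rewrite [x + _]addrC.
rewrite -E; case: dc => dc <-; exact: dc.
Qed.

Lemma is_derive_finv F x v (d : R) : is_derive x v F d -> F x != 0 ->
  is_derive x v (fun y => (F y)^-1) (- (F x)^-2 * d).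
Proof.
move=> [dF <-] Fx; apply: DeriveDef; first exact: derivableV.
by rewrite deriveV.
Qed.

Lemma is_derive_unique F x v (a b : R) :
  is_derive x v F a -> is_derive x v F b -> a = b.
Proof. by move=> [_ <-] [_ <-]. Qed.

End DirectionalDerivatives.

Section RealFunctions.
Context {R : realType}.
Implicit Types f df : R -> R.

Lemma is_derive1_continuous f (x d : R) : is_derive x 1 f d -> {for x, continuous f}.
Proof. by move=> [/derivable1_diffP/differentiable_continuous]. Qed.

Lemma mean_value f df (a b : R) : a <= b ->
  (forall x, a <= x <= b -> is_derive x 1 f (df x)) ->
  exists2 c, a <= c <= b & f b - f a = df c * (b - a).
Proof.
move=> ab fdf.
have [||c cab E] := @MVT_segment _ f df a b ab.
- by move=> x; rewrite in_itv/= => /andP[ax xb]; apply: fdf; rewrite !ltW.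
- apply: continuous_in_subspaceT => x; rewrite inE/= in_itv/= => xab.
  exact: is_derive1_continuous (fdf _ xab).
by exists c => //; move: cab; rewrite in_itv.
Qed.

Lemma derive_ge0_le f df (a b : R) : a <= b ->
  (forall x, a <= x <= b -> is_derive x 1 f (df x)) ->
  (forall x, a <= x <= b -> 0 <= df x) -> f a <= f b.
Proof.
move=> ab fdf df0; have [c cab E] := mean_value ab fdf.
by rewrite -subr_ge0 E mulr_ge0 ?subr_ge0// df0.
Qed.

Lemma derive_le0_ge f df (a b : R) : a <= b ->
  (forall x, a <= x <= b -> is_derive x 1 f (df x)) ->
  (forall x, a <= x <= b -> df x <= 0) -> f b <= f a.
Proof.
move=> ab fdf df0; have [c cab E] := mean_value ab fdf.
by rewrite -subr_le0 E mulr_le0_ge0 ?subr_ge0// df0.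
Qed.

End RealFunctions.

(** * Partial and directional derivatives in dimension three *)

Section Space.
Context {R : realType}.
Notation V := 'rV[R]_3.
Implicit Types (F : V -> R) (x y v : V) (a b k : 'I_3).

Definition axis k : V := delta_mx 0 k.

Lemma partial_is_derive k F x (d : R) : is_derive x (axis k) F d -> partial k F x = d.
Proof. by case. Qed.

Lemma axisE k j : axis k 0 j = (j == k)%:R.
Proof. by rewrite mxE eqxx. Qed.

Lemma is_derive_coord x v k : is_derive x v (fun y : V => y 0 k) (v 0 k).
Proof.
apply: is_derive_cvg; rewrite -[X in _ --> X]/(v 0 k).
apply: cvg_near_cst; near=> h; rewrite !mxE addrK /GRing.scale/= mulrA mulVf ?mul1r//.
by near: h; exact: nbhs_dnbhs_neq.
Unshelve. all: by end_near. Qed.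

Lemma ord3_ind (P : 'I_3 -> Prop) : P 0 -> P 1 -> P 2%:R -> forall k, P k.
Proof.
move=> P0 P1 P2 -[[|[|[|//]]] i].
- by rewrite (_ : Ordinal i = 0)//; exact: val_inj.
- by rewrite (_ : Ordinal i = 1)//; exact: val_inj.
- by rewrite (_ : Ordinal i = 2%:R)//; exact: val_inj.
Qed.

Lemma sum3E (G : 'I_3 -> R) : \sum_k G k = G 0 + G 1 + G 2%:R.
Proof.
by rewrite !big_ord_recl big_ord0 addr0 addrA; congr (_ + G _ + G _); exact: val_inj.
Qed.

Lemma vec_axisE v : v = v 0 0 *: axis 0 + v 0 1 *: axis 1 + v 0 2%:R *: axis 2%:R.
Proof.
by apply/rowP; apply: ord3_ind; rewrite !mxE/= ?(mulr1,mulr0,addr0,add0r).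
Qed.

(** Parametrising the segment by s t with t in [0, 1] treats both signs of [s] at once. *)
Lemma axis_increment k F x (s : R) :
  (forall t, `|t| <= `|s| -> derivable F (x + t *: axis k) (axis k)) ->
  exists2 t, `|t| <= `|s| &
    F (x + s *: axis k) - F x = s * partial k F (x + t *: axis k).
Proof.
move=> dF; pose G (t : R) := F (x + t *: axis k).
have dG (t : R) : `|t| <= `|s| -> is_derive t 1 G (partial k F (x + t *: axis k)).
  by move=> ts; apply: is_derive_line; apply/derivableP/dF.
have ts (t : R) : 0 <= t <= 1 -> `|s * t| <= `|s|.
  by move=> /andP[t0 t1]; rewrite normrM (ger0_norm t0) ler_piMr.
have [|c c01] := @mean_value _ (fun t => G (s * t))
   (fun t => partial k F (x + (s * t) *: axis k) * (s * 1)) 0 1 ler01.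
  move=> t t01; by apply: is_derive_comp1; exact/dG/ts.
rewrite subr0 !mulr1 mulr0 /G scale0r addr0 => E.
by exists (s * c); [exact: ts|rewrite E mulrC].
Qed.

Lemma ball_rowP x y (e : R) : 0 < e -> (forall k, `|x 0 k - y 0 k| < e) -> ball x e y.
Proof. by move=> e0 xy; split=> // i j; rewrite (ord1 i); exact: xy. Qed.

Let telescope4 (a b c d : R) : d - a = b - a + (c - b) + (d - c).
Proof. ring. Qed.

Let dot3B (a b c p q r p' q' r' : R) : a * p + b * q + c * r - (a * p' + b * q' + c * r') =
  a * (p - p') + b * (q - q') + c * (r - r').
Proof. ring. Qed.

(** The classical argument that continuous partial derivatives yield all directional ones: the
    increment is cut into three moves parallel to the axes, each evaluated by the mean value theorem
    at a point close to [x]. *)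
Lemma is_derive_direction F x v :
  (\forall y \near x, forall k, derivable F y (axis k)) ->
  (forall k, {for x, continuous (partial k F)}) ->
  is_derive x v F (\sum_k v 0 k * partial k F x).
Proof.
move=> dF cF; apply: is_derive_cvg; apply/cvgrPdist_le => /= e e0.
(* [W] bounds the sum of the weights [|v 0 k|] in the error, and [|h| * W] bounds each coordinate
   move; the summand 1 keeps it positive. *)
pose W := 1 + \sum_k `|v 0 k|.
have W0 : 0 < W by rewrite ltr_pwDl// sumr_ge0.
have : \forall y \near x, (forall k, derivable F y (axis k)) /\
    forall k, `|partial k F x - partial k F y| <= e / W.
  apply: filterI => //.
  have H k : \forall y \near x, `|partial k F x - partial k F y| <= e / W.
    by move/cvgrPdist_le: (cF k); apply; rewrite divr_gt0.
  by apply: filterS (filterI (H 0) (filterI (H 1) (H 2%:R))) => y [H0 [H1 H2]];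
    exact: ord3_ind.
move=> /nbhs_ballP[d /= d0 Hd].
near=> h.
have h0 : h != 0 by near: h; exact: nbhs_dnbhs_neq.
have hd : `|h| * W < d.
  rewrite -ltr_pdivlMr//; near: h.
  apply/dnbhs0_lt; by rewrite divr_gt0.
have small (c0 c1 c2 : R) : `|c0| <= `|h * v 0 0| -> `|c1| <= `|h * v 0 1| ->
    `|c2| <= `|h * v 0 2%:R| ->
    ball x d (x + c0 *: axis 0 + c1 *: axis 1 + c2 *: axis 2%:R).
  have hv k : `|h * v 0 k| < d.
    apply: le_lt_trans hd; rewrite normrM ler_wpM2l// /W (bigD1 k)//=.
    by rewrite addrCA lerDl addr_ge0// sumr_ge0.
  move=> H0 H1 H2; apply: ball_rowP => //; apply: ord3_ind;
  rewrite !mxE/= ?(mulr1,mulr0,addr0,add0r) opprD addrA subrr add0r normrN.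
  - by apply: le_lt_trans H0 _; exact: hv.
  - by apply: le_lt_trans H1 _; exact: hv.
  - by apply: le_lt_trans H2 _; exact: hv.
have z0 (y : R) : `|0 : R| <= `|y| by rewrite normr0.
have [t0 t0h E0] : exists2 t, `|t| <= `|h * v 0 0| &
    F (x + (h * v 0 0) *: axis 0) - F x = h * v 0 0 * partial 0 F (x + t *: axis 0).
  apply: axis_increment => t th.
  have /Hd[+ _] := small t 0 0 th (z0 _) (z0 _).
  by rewrite !scale0r !addr0; exact.
have [t1 t1h E1] := @axis_increment 1 F (x + (h * v 0 0) *: axis 0) (h * v 0 1)
   (fun t th => ltac:(
    have /Hd[+ _] := small (h * v 0 0) t 0 (lexx _) th (z0 _);
    by rewrite !scale0r !addr0; exact)).
have [t2 t2h E2] := @axis_increment 2%:R F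
   (x + (h * v 0 0) *: axis 0 + (h * v 0 1) *: axis 1) (h * v 0 2%:R)
   (fun t th => ltac:(
    have /Hd[+ _] := small (h * v 0 0) (h * v 0 1) t (lexx _) (lexx _) th; exact)).
have /Hd[_ /(_ 0) D0] := small t0 0 0 t0h (z0 _) (z0 _).
have /Hd[_ /(_ 1) D1] := small (h * v 0 0) t1 0 (lexx _) t1h (z0 _).
have /Hd[_ /(_ 2%:R) D2] := small (h * v 0 0) (h * v 0 1) t2 (lexx _) (lexx _) t2h.
rewrite !scale0r !addr0 in D0 D1.
have -> : h *: v + x = x + (h * v 0 0) *: axis 0 + (h * v 0 1) *: axis 1
     + (h * v 0 2%:R) *: axis 2%:R.
  by rewrite [in LHS](vec_axisE v) !scalerDr !scalerA addrC !addrA.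
set X3 := (x + _ + _ + _) in E2 *.
have -> : F X3 - F x = h * (v 0 0 * partial 0 F (x + t0 *: axis 0)
   + v 0 1 * partial 1 F (x + (h * v 0 0) *: axis 0 + t1 *: axis 1)
   + v 0 2%:R * partial 2%:R F (x + (h * v 0 0) *: axis 0 + (h * v 0 1) *: axis 1
         + t2 *: axis 2%:R)).
  by rewrite !mulrDr !mulrA -E0 -E1 -E2 -telescope4.
rewrite /GRing.scale/= mulrA mulVf// mul1r.
set p0 := partial 0 F _ in D0 *; set p1 := partial 1 F _ in D1 *.
set p2 := partial 2%:R F _ in D2 *.
apply: (@le_trans _ _ (\sum_k `|v 0 k| * (e / W))); last first.
  by rewrite -mulr_suml mulrCA ger_pMr// ler_pdivrMr// mul1r /W lerDr.
rewrite !sum3E dot3B.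
apply: le_trans (ler_normD _ _) _; apply: lerD; last first.
  by rewrite normrM; exact: ler_wpM2l (normr_ge0 _) _ _ D2.
apply: le_trans (ler_normD _ _) _; apply: lerD; rewrite normrM.
  exact: ler_wpM2l (normr_ge0 _) _ _ D0.
exact: ler_wpM2l (normr_ge0 _) _ _ D1.
Unshelve. all: by end_near. Qed.

End Space.

Section FiniteOperations.
Context {R : realType} {T : topologicalType} {I : Type}.
Variables (r : seq I) (P : pred I) (F : I -> T -> R) (x : T).
Hypothesis cF : forall i, {for x, continuous (F i)}.

Lemma continuous_fsum : {for x, continuous (fun y => \sum_(i <- r | P i) F i y)}.
Proof.
rewrite /prop_for /continuous_at; elim: r => [|i s IH].
  by under eq_fun do rewrite big_nil; rewrite big_nil; exact: cvg_cst.
under eq_fun do rewrite big_cons; rewrite big_cons.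
by case: (P i) => //; apply: cvgD => //; exact: cF.
Qed.

Lemma continuous_fprod : {for x, continuous (fun y => \prod_(i <- r | P i) F i y)}.
Proof.
rewrite /prop_for /continuous_at; elim: r => [|i s IH].
  by under eq_fun do rewrite big_nil; rewrite big_nil; exact: cvg_cst.
under eq_fun do rewrite big_cons; rewrite big_cons.
by case: (P i) => //; apply: cvgM => //; exact: cF.
Qed.

End FiniteOperations.

(** * Euclidean space and smooth functions *)

Section EuclideanNorm.
Context {R : realType}.
Notation V := 'rV[R]_3.
Implicit Types (x y v : V) (k : 'I_3) (r s t : R).

Lemma enorm_ge0 x : 0 <= enorm x. Proof. exact: sqrtr_ge0. Qed.

Lemma sqr_enorm x : enorm x ^+ 2 = \sum_k x 0 k ^+ 2.
Proof. by rewrite sqr_sqrtr// sumr_ge0// => k _; rewrite sqr_ge0. Qed.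

Lemma enormZ t x : enorm (t *: x) = `|t| * enorm x.
Proof.
rewrite /enorm -sqrtr_sqr -sqrtrM ?sqr_ge0// mulr_sumr; congr Num.sqrt.
by apply: eq_bigr => k _; rewrite mxE exprMn.
Qed.

Lemma coord_le_enorm x k : `|x 0 k| <= enorm x.
Proof.
rewrite -sqrtr_sqr ler_sqrt; last by rewrite sumr_ge0// => j _; rewrite sqr_ge0.
by rewrite (bigD1 k)//= lerDl sumr_ge0// => j _; rewrite sqr_ge0.
Qed.

Lemma enorm_axis k : enorm (axis k : V) = 1.
Proof.
rewrite /enorm (bigD1 k)//= axisE eqxx expr1n big1 ?addr0 ?sqrtr1// => j /negbTE jk.
by rewrite axisE jk expr0n.
Qed.

Lemma enorm_continuous : continuous (@enorm R).
Proof.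
move=> x; apply: (@continuous_comp _ _ _ (fun y : V => \sum_(a < 3) y 0 a ^+ 2)
  (@Num.sqrt R)); last exact: sqrt_continuous.
apply: continuous_fsum => k.
apply: (@continuous_comp _ _ _ (fun y : V => y 0 k) (fun z : R => z ^+ 2)).
  exact: coord_continuous.
exact: exprn_continuous.
Qed.

Lemma exterior_open r : open (exterior r : set V).
Proof.
have /continuousP/(_ _ (@open_gt R r)) H := enorm_continuous.
rewrite (_ : exterior r = @enorm R @^-1` [set z | r < z])//.
Qed.

Lemma subset_exterior s t : s <= t -> exterior t `<=` (exterior s : set V).
Proof. by move=> st x; exact: le_lt_trans. Qed.

Lemma exterior_ge1 r x : 1 <= r -> exterior r x -> 1 <= enorm x.
Proof. by move=> r1 /ltW; exact: le_trans. Qed.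

Definition annulus r s : set V := [set x | r <= enorm x <= s].

Lemma annulus_compact r s : compact (annulus r s).
Proof.
apply: bounded_closed_compact.
  exists s; split; first exact: num_real.
  move=> M sM x /= /andP[_ xs]; rewrite /Num.norm/= mx_normrE.
  apply: bigmax_le => [|[i j] _/=]; first exact: le_trans (enorm_ge0 x) (le_trans xs (ltW sM)).
  rewrite (ord1 i); exact: le_trans (coord_le_enorm _ _) (le_trans xs (ltW sM)).
rewrite [X in closed X](_ : _ = (@enorm R) @^-1` `[r, s]%classic).
  apply: preimage_closed; last exact: interval_closed.
  by move=> x _; exact: enorm_continuous.
by apply/seteqP; split=> x /=; rewrite /annulus/= in_itv.
Qed.

Lemma annulus_bounded r s (F : V -> R) :
  (forall x, annulus r s x -> {for x, continuous F}) ->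
  exists2 C, 0 <= C & forall x, annulus r s x -> `|F x| <= C.
Proof.
move=> cF; have [[x0 Ax0]|A0] := pselect (annulus r s !=set0); last first.
  by exists 0 => // x Ax; case: A0; exists x.
have [|||c Ac H] := @EVT_max_rV R 3 (fun x => `|F x|) (annulus r s).
- by exists x0.
- exact: annulus_compact.
- apply: continuous_in_subspaceT => x; rewrite inE => /cF cFx.
  exact: (@continuous_comp _ _ _ F (@Num.norm R R)) cFx (@norm_continuous _ _ _).
by exists `|F c| => // x Ax; apply: H; rewrite inE.
Qed.

Definition ray_dir x : V := (enorm x)^-1 *: x.

Lemma enorm_ray_dir x : 0 < enorm x -> enorm (ray_dir x) = 1.
Proof. by move=> x0; rewrite enormZ ger0_norm ?invr_ge0 ?ltW// mulVf// gt_eqF. Qed.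

Lemma ray_dirK x : 0 < enorm x -> enorm x *: ray_dir x = x.
Proof. by move=> x0; rewrite scalerA divff ?scale1r// gt_eqF. Qed.

End EuclideanNorm.

Section Smoothness.
Context {R : realType}.
Notation V := 'rV[R]_3.
Implicit Types (F G : V -> R) (U : set V) (x v : V) (k : 'I_3) (s : seq 'I_3).

Lemma partials_local U F G s : open U -> (forall x, U x -> F x = G x) ->
  forall x, U x -> partials s F x = partials s G x.
Proof.
move=> oU FG; elim: s => //= k s IH x Ux; rewrite /partial.
apply: near_eq_derive; apply: filterS (open_nbhs_nbhs (conj oU Ux)) => y.
exact: IH.
Qed.

(** Near a point of an open set the local extension agrees with [F], hence so do all iterated
    partial derivatives. *)
Lemma smooth_on_openE U F : open U -> smooth_on U F -> smooth_on_open U F.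
Proof.
move=> oU sF s x Ux.
have [W [G [oW Wx sG FG]]] := sF x Ux.
have oUW : open (U `&` W) by exact: openI.
have E : \near x, partials s G x = partials s F x.
  apply: filterS (open_nbhs_nbhs (conj oUW (conj Ux Wx))) => y UWy.
  apply/esym; apply: partials_local oUW _ _ UWy => z UWz.
  by apply: FG; rewrite inE.
have [cG dG] := sG s x Wx; split.
  rewrite /prop_for /continuous_at -(nbhs_singleton E).
  by apply: cvg_trans cG; exact: (near_eq_cvg E).
move=> k; exact: (near_eq_derivable E (dG k)).
Qed.

Variables (U : set V) (F : V -> R).
Hypotheses (oU : open U) (sF : smooth_on_open U F).

Lemma smooth_continuous s x : U x -> {for x, continuous (partials s F)}.
Proof. by move=> Ux; case: (sF s Ux). Qed.

Lemma smooth_partial s k x : U x ->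
  is_derive x (axis k) (partials s F) (partials (k :: s) F x).
Proof. by move=> Ux; case: (sF s Ux) => _ /(_ k)/derivableP. Qed.

Lemma smooth_direction s v x : U x ->
  is_derive x v (partials s F) (\sum_k v 0 k * partials (k :: s) F x).
Proof.
move=> Ux; apply: is_derive_direction; last first.
  by move=> k; exact: (@smooth_continuous (k :: s)).
apply: filterS (open_nbhs_nbhs (conj oU Ux)) => y Uy k.
by case: (sF s Uy) => _; exact.
Qed.

Lemma smooth_line s x v (t : R) : U (x + t *: v) ->
  is_derive t 1 (fun u => partials s F (x + u *: v))
    (\sum_k v 0 k * partials (k :: s) F (x + t *: v)).
Proof. by move=> Ux; apply: is_derive_line; exact: smooth_direction. Qed.

End Smoothness.

(** * Power bounds *)

Section Powers.
Context {R : realType}.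
Implicit Types p q s t e : R.

Lemma powR_addE s p q : 0 < s -> s `^ (p + q) = s `^ p * s `^ q.
Proof. by move=> s0; rewrite powRD// (gt_eqF s0) implybT. Qed.

Lemma powR_le0_anti p s t : p <= 0 -> 0 < s -> s <= t -> t `^ p <= s `^ p.
Proof.
move=> p0 s0 st; rewrite -[p]opprK !(powRN _ (- p)) lef_pV2 ?posrE ?powR_gt0//.
  by apply: ge0_ler_powR; rewrite ?nnegrE ?oppr_ge0// ltW// (lt_le_trans s0).
exact: lt_le_trans st.
Qed.

Lemma powR_small q e : q < 0 -> 0 < e ->
  exists2 T, 0 < T & forall t, T <= t -> t `^ q <= e.
Proof.
move=> q0 e0; exists (e `^ q^-1); first exact: powR_gt0.
move=> t Tt; apply: le_trans (powR_le0_anti (ltW q0) _ Tt) _.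
  exact: powR_gt0.
by rewrite -powRrM mulVf ?(lt_eqF q0)// powRr1// ltW.
Qed.

(** Stands for letting t tend to infinity in an inequality with a decaying error. *)
Lemma le_of_powR_decay q a b c t0 : q < 0 ->
  (forall t, t0 <= t -> a <= c * t `^ q + b) -> a <= b.
Proof.
move=> q0 H; apply/ler_addgt0Pr => e e0.
have c1 : 0 < `|c| + 1 by rewrite ltr_wpDl.
have [T T0 HT] := @powR_small q (e / (`|c| + 1)) q0 ltac:(by rewrite divr_gt0).
apply: le_trans (H (Num.max t0 T) _) _; first by rewrite le_max lexx.
have HTt : (Num.max t0 T) `^ q <= e / (`|c| + 1) by apply: HT; rewrite le_max lexx orbT.
rewrite addrC lerD2l; apply: (@le_trans _ _ (`|c| * (e / (`|c| + 1)))).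
  apply: (@le_trans _ _ (`|c| * Num.max t0 T `^ q)); last exact: ler_wpM2l.
  by rewrite ler_wpM2r ?powR_ge0// ler_norm.
by rewrite mulrCA ger_pMr// ler_pdivrMr// mul1r lerDl.
Qed.

(** Integration of the bound C u^(p - 1) without an integral: adding C/p u^p to phi gives a
    nondecreasing function, subtracting it a nonincreasing one. Both signs of [p] are covered, for
    growth and for decay. *)
Lemma powR_increment (phi dphi : R -> R) (C p s t : R) : p != 0 -> 0 < s -> s <= t ->
  (forall u, s <= u <= t -> is_derive u 1 phi (dphi u)) ->
  (forall u, s <= u <= t -> `|dphi u| <= C * u `^ (p - 1)) ->
  `|phi t - phi s| <= C / p * (t `^ p - s `^ p).
Proof.
move=> p0 s0 st dp bp.
have pw u : s <= u <= t -> is_derive u 1 (fun u => C / p * u `^ p) (C * u `^ (p - 1)).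
  move=> /andP[su _]; have u0 : 0 < u by exact: lt_le_trans su.
  have := @is_derive_fZ R R (fun u => u `^ p) u 1 (C / p) _ (@is_derive1_powR R p u u0).
  by rewrite mulrA divfK.
rewrite ler_norml; apply/andP; split.
  suff : phi s + C / p * s `^ p <= phi t + C / p * t `^ p by lra.
  apply: (@derive_ge0_le R (fun u => phi u + C / p * u `^ p)
    (fun u => dphi u + C * u `^ (p - 1)) s t st) => u ut.
    by apply: is_derive_fD; [exact: dp|exact: pw].
  by move: (bp u ut); rewrite ler_norml => /andP[+ _]; rewrite -subr_ge0 opprK addrC.
suff : phi t - C / p * t `^ p <= phi s - C / p * s `^ p by lra.
apply: (@derive_le0_ge R (fun u => phi u - C / p * u `^ p)
    (fun u => dphi u - C * u `^ (p - 1)) s t st) => u ut.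
  by apply: is_derive_fB; [exact: dp|exact: pw].
by move: (bp u ut); rewrite ler_norml => /andP[_]; rewrite -subr_le0.
Qed.

End Powers.

Section PowerBounds.
Context {R : realType}.
Notation V := 'rV[R]_3.
Implicit Types (A B : set V) (F G : V -> R) (p q r : R).

(** The exponent carries its own sign, unlike in [bigO_deriv], so that exponents add under
    products. *)
Definition bigo A p F := exists2 C, 0 <= C & forall x, A x -> `|F x| <= C * enorm x `^ p.

Lemma bigo_intro A p F C : (forall x, A x -> `|F x| <= C * enorm x `^ p) -> bigo A p F.
Proof.
move=> H; exists `|C| => // x Ax; apply: le_trans (H x Ax) _.
by rewrite ler_wpM2r ?powR_ge0// ler_norm.
Qed.

Lemma bigo_sub A B p F : A `<=` B -> bigo B p F -> bigo A p F.
Proof. by move=> AB [C C0 H]; exists C => // x /AB; exact: H. Qed.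

Lemma bigo_ext A p F G : (forall x, A x -> F x = G x) -> bigo A p F -> bigo A p G.
Proof. by move=> FG [C C0 H]; exists C => // x Ax; rewrite -FG// H. Qed.

Lemma bigoD A p F G : bigo A p F -> bigo A p G -> bigo A p (fun x => F x + G x).
Proof.
move=> [C C0 HF] [D D0 HG]; exists (C + D); first exact: addr_ge0.
move=> x Ax; apply: le_trans (ler_normD _ _) _.
by rewrite mulrDl lerD ?HF ?HG.
Qed.

Lemma bigoN A p F : bigo A p F -> bigo A p (fun x => - F x).
Proof. by move=> [C C0 H]; exists C => // x Ax; rewrite normrN H. Qed.

Lemma bigoB A p F G : bigo A p F -> bigo A p G -> bigo A p (fun x => F x - G x).
Proof. by move=> HF HG; apply: bigoD => //; exact: bigoN. Qed.

Lemma bigoZ A p (c : R) F : bigo A p F -> bigo A p (fun x => c * F x).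
Proof.
move=> [C C0 H]; exists (`|c| * C); first exact: mulr_ge0.
by move=> x Ax; rewrite normrM -mulrA ler_wpM2l// H.
Qed.

Lemma bigo_zero A p : bigo A p (fun=> 0).
Proof. by exists 0 => // x _; rewrite normr0 mul0r. Qed.

Lemma bigo_fsum A p (I : Type) (s : seq I) (P : pred I) (F : I -> V -> R) :
  (forall i, bigo A p (F i)) -> bigo A p (fun x => \sum_(i <- s | P i) F i x).
Proof.
move=> H; elim: s => [|i s IH].
  by apply: bigo_ext (bigo_zero A p) => x _; rewrite big_nil.
case Pi: (P i); last by apply: bigo_ext IH => x _; rewrite big_cons Pi.
by apply: bigo_ext (bigoD (H i) IH) => x _; rewrite big_cons Pi.
Qed.

Lemma bigo_cst A (c : R) : bigo A 0 (fun=> c).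
Proof. by exists `|c| => // x _; rewrite powRr0 mulr1. Qed.

Lemma bigoM A p q r F G : (forall x, A x -> 0 < enorm x) -> r = p + q ->
  bigo A p F -> bigo A q G -> bigo A r (fun x => F x * G x).
Proof.
move=> A0 -> [C C0 HF] [D D0 HG]; exists (C * D); first exact: mulr_ge0.
move=> x Ax; rewrite normrM powR_addE; last exact: A0.
by rewrite mulrACA; apply: ler_pM => //; [exact: HF|exact: HG].
Qed.

(** Comparing two powers requires |x| >= 1; this is why the radii of the linear theory are taken to
    be at least 1. *)
Lemma bigo_weak A p q F : (forall x, A x -> 1 <= enorm x) -> p <= q ->
  bigo A p F -> bigo A q F.
Proof.
move=> A1 pq [C C0 H]; exists C => // x Ax; apply: le_trans (H x Ax) _.
by rewrite ler_wpM2l// ler_powR// A1.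
Qed.

Lemma bigo_perturb A p q F G : (forall x, A x -> 1 <= enorm x) -> q <= p ->
  bigo A q (fun x => F x - G x) -> bigo A p G -> bigo A p F.
Proof.
move=> A1 qp FG GO; apply: bigo_ext (bigoD (bigo_weak A1 qp FG) GO) => x _.
exact: subrK.
Qed.

Lemma bigo_coord A k : bigo A 1 (fun x => x 0 k).
Proof.
by exists 1 => // x _; rewrite mul1r powRr1 ?enorm_ge0// coord_le_enorm.
Qed.

Lemma bigo_powR A p : bigo A p (fun x => enorm x `^ p).
Proof. by exists 1 => // x _; rewrite mul1r ger0_norm// powR_ge0. Qed.

End PowerBounds.

(** * Integration on exterior domains *)

Section ExteriorGradients.
Context {R : realType}.
Notation V := 'rV[R]_3.
Variables (r : R) (F : V -> R) (D : 'I_3 -> V -> R).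
Hypothesis r0 : 0 < r.

(** The gradient [D] is a parameter rather than the partial derivatives of [F], so that f - a.x can
    be treated with gradient df - a. *)
Definition has_gradient := forall x v, exterior r x ->
  is_derive x v F (\sum_k v 0 k * D k x).
Hypothesis FD : has_gradient.

Lemma gradient_line (x v : V) t : exterior r (x + t *: v) ->
  is_derive t 1 (fun u => F (x + u *: v)) (\sum_k v 0 k * D k (x + t *: v)).
Proof. by move=> xv; apply: is_derive_line; exact: FD. Qed.

Lemma exterior_ray (th : V) t : enorm th = 1 -> r < t -> exterior r (t *: th).
Proof.
by move=> th1 rt; rewrite /exterior/= enormZ th1 mulr1 ger0_norm// ltW// (lt_trans r0).
Qed.

Lemma gradient_dot_le (v : V) x C (c : R) : (forall k, `|v 0 k| <= c) ->
  (forall k, `|D k x| <= C) -> `|\sum_k v 0 k * D k x| <= 3 * c * C.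
Proof.
move=> vc DC; apply: le_trans (ler_norm_sum _ _ _) _.
apply: (@le_trans _ _ (\sum_(k < 3) c * C)).
  by apply: ler_sum => k _; rewrite normrM ler_pM.
by rewrite sumr_const card_ord -[leLHS]mulr_natl mulrA.
Qed.

Variables (C p : R).
Hypothesis p0 : p != 0.
Hypothesis DC : forall k x, exterior r x -> `|D k x| <= C * enorm x `^ (p - 1).

Lemma ray_increment (th : V) s t : enorm th = 1 -> r < s -> s <= t ->
  `|F (t *: th) - F (s *: th)| <= 3 * C / p * (t `^ p - s `^ p).
Proof.
move=> th1 rs st; have s0 : 0 < s by exact: lt_trans rs.
have Fr u : r < u -> is_derive u 1 (fun w => F (w *: th)) (\sum_k th 0 k * D k (u *: th)).
  move=> ru; have := @gradient_line 0 th u; under eq_fun do rewrite add0r.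
  by rewrite add0r; apply; exact: exterior_ray.
apply: (@powR_increment R (fun w => F (w *: th))
  (fun u => \sum_k th 0 k * D k (u *: th))) => // u /andP[su _].
  by apply: Fr; exact: lt_le_trans su.
have ru := lt_le_trans rs su.
have -> : 3 * C * u `^ (p - 1) = 3 * 1 * (C * u `^ (p - 1)) by rewrite mulr1 mulrA.
apply: gradient_dot_le => k; first by rewrite -th1 coord_le_enorm.
have u0 := ltW (lt_trans r0 ru).
by have := DC k (exterior_ray th1 ru); rewrite enormZ th1 mulr1 (ger0_norm u0).
Qed.

(** When two points of a sphere are seen under at most a right angle, their chord stays outside the
    ball of half the radius: already its midpoint is at distance at least t / sqrt 2. This keeps
    chords inside the exterior domain. *)
Lemma enorm_segment_ge (x y : V) (s t : R) : 0 <= t -> enorm x = t -> enorm y = t ->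
  0 <= \sum_k x 0 k * y 0 k -> 0 <= s <= 1 -> t / 2 <= enorm (x + s *: (y - x)).
Proof.
move=> t0 xt yt xy /andP[s0 s1].
have := sqr_enorm x; have := sqr_enorm y; rewrite xt yt => Ey Ex.
rewrite -(@ler_pXn2r _ 2)// ?nnegrE ?enorm_ge0 ?divr_ge0// sqr_enorm.
have -> : \sum_k (x + s *: (y - x)) 0 k ^+ 2 = (1 - s) ^+ 2 * (\sum_k x 0 k ^+ 2)
   + s ^+ 2 * (\sum_k y 0 k ^+ 2) + 2 * s * (1 - s) * (\sum_k x 0 k * y 0 k).
  by rewrite !mulr_sumr -!big_split/=; apply: eq_bigr => k _; rewrite !mxE; ring.
rewrite -Ex -Ey; move: (\sum_k x 0 k * y 0 k) xy => w w0.
have : 0 <= 2 * s * (1 - s) * w by rewrite !mulr_ge0 ?subr_ge0.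
have : 0 <= (s - 1 / 2) ^+ 2 * t ^+ 2 by rewrite mulr_ge0 ?sqr_ge0.
have : 0 <= t ^+ 2 by exact: sqr_ge0.
by rewrite expr_div_n; move: (2 * s * (1 - s) * w) (t ^+ 2) => W T; lra.
Qed.

Lemma sphere_increment (x y : V) t : p <= 1 -> 0 <= C -> 2 * r < t ->
  enorm x = t -> enorm y = t -> 0 <= \sum_k x 0 k * y 0 k ->
  `|F y - F x| <= 12 * C * 2^-1 `^ p * t `^ p.
Proof.
move=> p1 C0 rt xt yt xy.
have t0 : 0 < t by rewrite (lt_trans _ rt)// mulr_gt0.
have sg s : 0 <= s <= 1 -> t / 2 <= enorm (x + s *: (y - x)).
  exact: enorm_segment_ge (ltW t0) xt yt xy.
have sr s : 0 <= s <= 1 -> exterior r (x + s *: (y - x)).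
  by move=> /sg; apply: lt_le_trans; rewrite ltr_pdivlMr// mulrC.
have [s s01 E] := mean_value ler01 (fun s s01 => gradient_line (sr s s01)).
rewrite subr0 mulr1 scale1r scale0r addr0 [x + _]addrC subrK in E; rewrite E.
(* The chord changes each coordinate by at most 2 t, and the gradient on it is at most C (t / 2)^(p
   - 1) since p <= 1; the three coordinates and the factor t / (t / 2) make up 12. *)
have -> : 12 * C * 2^-1 `^ p * t `^ p = 3 * (2 * t) * (C * (t / 2) `^ (p - 1)).
  rewrite powR_addE ?divr_gt0// powRN powRr1 ?divr_ge0 ?(ltW t0)//.
  by rewrite powRM ?(ltW t0)//; field; rewrite (gt_eqF t0).
apply: gradient_dot_le => k.
  rewrite !mxE; apply: le_trans (ler_normB _ _) _.
  by rewrite mulr_natl mulr2n -{1}yt -xt lerD ?coord_le_enorm.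
apply: le_trans (DC _ (sr s s01)) _; rewrite ler_wpM2l//.
by apply: powR_le0_anti; [rewrite subr_le0|rewrite divr_gt0|exact: sg].
Qed.

(** Integration from infinity along the ray. Any decay rate [q] serves to fix the integration
    constant at 0, and the resulting constant depends neither on [q] nor on [C1]; the contraction
    argument relies on this. *)
Lemma gradient_decay (q C1 : R) : p < 0 -> 0 <= C -> q < 0 ->
  (forall x, exterior r x -> `|F x| <= C1 * enorm x `^ q) ->
  forall x, exterior r x -> `|F x| <= 3 * C / - p * enorm x `^ p.
Proof.
move=> pN C0 qN FC x rx; have s0 : 0 < enorm x by exact: lt_trans rx.
have th1 := enorm_ray_dir s0.
apply: (@le_of_powR_decay _ q _ _ C1 (enorm x)) => // t st.
have rt : r < t by exact: lt_le_trans st.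
have inc := ray_increment th1 rx st; rewrite ray_dirK// in inc.
have Ft := FC _ (exterior_ray th1 rt).
rewrite enormZ th1 mulr1 (ger0_norm (ltW (lt_trans r0 rt))) in Ft.
have : 0 <= 3 * C / - p * t `^ p.
  by rewrite mulr_ge0 ?powR_ge0// divr_ge0 ?mulr_ge0// oppr_ge0 ltW.
rewrite mulrBr !invrN !mulrN !mulNr in inc *.
have := ler_normB (F (t *: ray_dir x)) (F (t *: ray_dir x) - F x).
rewrite opprB addrC subrK.
by move: `|F x| inc Ft => N; lra.
Qed.

(** Integration outwards from the sphere of radius 2 r, on which compactness bounds [F]. *)
Lemma gradient_growth : 0 < p -> 0 <= C ->
  (forall x, exterior r x -> {for x, continuous F}) -> bigo (exterior (2 * r)) p F.
Proof.
move=> pP C0 cF.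
have r2 : r < 2 * r by rewrite ltr_pMl// ltr1n.
have [|M M0 HM] := @annulus_bounded R (2 * r) (2 * r) F.
  by move=> x /andP[rx _]; apply: cF; exact: lt_le_trans rx.
have r20 : 0 < (2 * r) `^ p by rewrite powR_gt0 ?mulr_gt0.
apply: (@bigo_intro _ _ _ _ (M / (2 * r) `^ p + 3 * C / p)) => x rx.
have s0 : 0 < enorm x by apply: lt_trans rx; rewrite mulr_gt0.
have th1 := enorm_ray_dir s0.
have inc := ray_increment th1 r2 (ltW rx); rewrite ray_dirK// in inc.
have := HM (2 * r *: ray_dir x).
rewrite /annulus/= enormZ th1 mulr1 ger0_norm ?mulr_ge0 ?(ltW r0)// lexx => /(_ isT) Ms.
apply: (@le_trans _ _ (`|F (2 * r *: ray_dir x)| + `|F x - F (2 * r *: ray_dir x)|)).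
  by have := ler_normD (F (2 * r *: ray_dir x)) (F x - F (2 * r *: ray_dir x));
    rewrite addrC subrK.
rewrite [leRHS]mulrDl lerD//; last first.
  apply: le_trans inc _; rewrite ler_wpM2l ?gerDl ?oppr_le0 ?powR_ge0//.
  by rewrite divr_ge0 ?mulr_ge0// ltW.
apply: le_trans Ms _; rewrite mulrAC -mulrA ler_peMr// ler_pdivlMr// mul1r.
apply: ge0_ler_powR; rewrite ?nnegrE ?mulr_ge0 ?enorm_ge0 ?(ltW pP) ?(ltW r0)//.
exact: ltW.
Qed.

(** Nested intervals: every lower end F - K t^p lies below every upper end F + K s^p, so the
    supremum of the lower ends belongs to all the intervals. *)
Lemma ray_limit (th : V) : p < 0 -> 0 <= C -> enorm th = 1 ->
  exists L, forall t, r < t -> `|F (t *: th) - L| <= 3 * C / - p * t `^ p.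
Proof.
move=> pN C0 th1; pose K := 3 * C / - p.
have K0 : 0 <= K by rewrite divr_ge0 ?mulr_ge0// oppr_ge0 ltW.
have inc s t : r < s -> s <= t -> `|F (t *: th) - F (s *: th)| <= K * (s `^ p - t `^ p).
  move=> rs st; apply: le_trans (ray_increment th1 rs st) _.
  by rewrite /K -opprB mulrN invrN !mulrN mulNr.
pose S : set R := [set F (t *: th) - K * t `^ p | t in [set t | r < t]].
have ub t : r < t -> ubound S (F (t *: th) + K * t `^ p).
  move=> rt _ [s rs <-].
  have Kt : 0 <= K * t `^ p by rewrite mulr_ge0 ?powR_ge0.
  have Ks : 0 <= K * s `^ p by rewrite mulr_ge0 ?powR_ge0.
  have [st|/ltW ts] := leP s t.
    by have := inc _ _ rs st; rewrite ler_norml mulrBr => /andP[? ?]; lra.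
  by have := inc _ _ rt ts; rewrite ler_norml mulrBr => /andP[? ?]; lra.
exists (sup S) => t rt; rewrite -/K ler_norml; apply/andP; split.
  suff : sup S <= F (t *: th) + K * t `^ p by lra.
  by apply: ge_sup (ub t rt); exists (F (t *: th) - K * t `^ p); exists t.
suff : F (t *: th) - K * t `^ p <= sup S by lra.
by apply: ub_le_sup; [exists (F (t *: th) + K * t `^ p); exact: ub|exists t].
Qed.

(** The limit is taken along one axis only. Moving along the sphere of radius |x| costs O(|x|^p) by
    [sphere_increment], so the same limit holds in every direction. *)
Lemma gradient_limit : p < 0 -> 0 <= C ->
  exists L, bigo (exterior (2 * r)) p (fun x => F x - L).
Proof.
move=> pN C0; have [L HL] := ray_limit pN C0 (enorm_axis 0).
exists L; apply: (@bigo_intro _ _ _ _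
  (12 * C * 2^-1 `^ p + 12 * C * 2^-1 `^ p + 3 * C / - p)) => x rx.
set t := enorm x.
have t0 : 0 < t by apply: lt_trans rx; rewrite mulr_gt0.
have rt : r < t by apply: lt_trans rx; rewrite ltr_pMl// ltr1n.
have p1 : p <= 1 by apply: le_trans (ltW pN) _.
(* One chord from [x] to the first axis could come too close to the origin. The intermediate point
   [z] on the second axis, with the sign of the matching coordinate of [x], makes both angles at
   most right angles. *)
pose z := (if 0 <= x 0 1 then t else - t) *: axis 1 : V.
have zt : enorm z = t.
  rewrite enormZ enorm_axis mulr1; case: ifP => _; rewrite ?normrN ger0_norm//; exact: ltW.
have yt : enorm (t *: axis 0 : V) = t by rewrite enormZ enorm_axis mulr1 ger0_norm// ltW.
have xz : 0 <= \sum_k x 0 k * z 0 k.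
  rewrite sum3E !mxE/= !mulr0 mulr1 add0r addr0.
  case: ifPn => [x1|]; first by rewrite mulr_ge0// ltW.
  by rewrite -ltNge => x1; rewrite mulr_le0// ?ltW// oppr_lt0.
have zy : 0 <= \sum_k z 0 k * (t *: axis 0 : V) 0 k.
  by rewrite sum3E !mxE/= !(mulr0,mul0r,addr0).
have H1 := sphere_increment p1 C0 rx erefl zt xz.
have H2 := sphere_increment p1 C0 rx zt yt zy.
have H3 := HL t rt.
have -> : F x - L = (F (t *: axis 0) - L) - (F z - F x) - (F (t *: axis 0) - F z) by ring.
apply: le_trans (ler_normB _ _) _; rewrite mulrDl (mulrDl _ _ (t `^ p)).
apply: (@le_trans _ _ (`|F (t *: axis 0) - L| + `|F z - F x| + `|F (t *: axis 0) - F z|)).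
  by rewrite lerD2r; exact: ler_normB.
by rewrite [leLHS]addrAC -[leLHS]addrA [leLHS]addrC; apply: lerD => //; rewrite addrC lerD.
Qed.

End ExteriorGradients.

(** * The linear system near infinity *)

Section LinearSystem.
Context {R : realType}.
Notation V := 'rV[R]_3.

Lemma bigo_uniform (A : set V) p (I : finType) (D : I -> V -> R) :
  (forall i, bigo A p (D i)) ->
  exists2 C, 0 <= C & forall i x, A x -> `|D i x| <= C * enorm x `^ p.
Proof.
move=> /(_ _)/cid2-/all_sig2[C C0 HC]; exists (\sum_i C i).
  by apply: sumr_ge0 => i _; exact: C0.
move=> i x Ax; apply: le_trans (HC i x Ax) _; rewrite ler_wpM2r ?powR_ge0//.
by rewrite (bigD1 i)//= lerDl sumr_ge0// => j _; exact: C0.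
Qed.

Variables (r : R) (f : V -> R).
Variables (Gam : 'I_3 -> 'I_3 -> 'I_3 -> V -> R) (P : 'I_3 -> 'I_3 -> V -> R).

Definition linear_hessian := forall a b x, exterior r x ->
  partials [:: a; b] f x = \sum_c Gam c a b x * partials [:: c] f x + P a b x * f x.

Hypotheses (r1 : 1 <= r) (sf : smooth_on_open (exterior r) f).
Hypothesis fE : linear_hessian.
Hypothesis GamO : forall c a b, bigo (exterior r) (- 2) (Gam c a b).
Hypothesis PO : forall a b, bigo (exterior r) (- 3) (P a b).

Let r0 : 0 < r. Proof. exact: lt_le_trans r1. Qed.
Let ext_pos t x : r <= t -> exterior t x -> 0 < enorm (x : V).
Proof. by move=> rt; apply: lt_trans; exact: lt_le_trans rt. Qed.

Lemma smooth_has_gradient s t : r <= t ->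
  has_gradient t (partials s f) (fun k => partials (k :: s) f).
Proof.
move=> rt x v tx; apply: smooth_direction sf _ _ _ _; first exact: exterior_open.
exact: subset_exterior tx.
Qed.

(** The coefficients decay like |x|^(-2) and |x|^(-3), so gradient and function contribute equally
    when their exponents are p + 2 and p + 3. *)
Lemma hessian_bigo p t : r <= t -> (forall c, bigo (exterior t) (p + 2) (partials [:: c] f)) ->
  bigo (exterior t) (p + 3) f -> forall a b, bigo (exterior t) p (partials [:: a; b] f).
Proof.
move=> rt dfO fO a b.
apply: bigo_ext (fun x tx => esym (fE a b (subset_exterior rt tx))) _.
apply: bigoD.
  apply: bigo_fsum => c; apply: (@bigoM _ _ (- 2) (p + 2)) (dfO c);
    [by move=> x; exact: ext_pos|by ring|].
  exact: bigo_sub (subset_exterior rt) (GamO c a b).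
apply: (@bigoM _ _ (- 3) (p + 3)) fO; [by move=> x; exact: ext_pos|by ring|].
exact: bigo_sub (subset_exterior rt) (PO a b).
Qed.

(* Along a ray, [E = 3 t^2 |df|^2 + f^2] satisfies [t E' <= 3 E] for large [t], so
   [E = O(t^3)]; here [y], [h] are the values of [df], [f] and [dd], [d0] their radial
   derivatives. *)
Lemma energy_ineq (t S q h d0 G : R) (y dd : 'I_3 -> R) : 0 < t -> 0 <= G -> 72 * G <= t ->
  S = \sum_j y j ^+ 2 -> q = \sum_j `|y j| -> `|d0| <= q ->
  (forall j, `|dd j| <= 3 * (G * t ^- 2 * q + G * t ^- 3 * `|h|)) ->
  t * (6 * t * S + 3 * t ^+ 2 * (\sum_j 2 * y j * dd j) + 2 * h * d0) <=
  3 * (3 * t ^+ 2 * S + h ^+ 2).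
Proof.
move=> t0 G0 tG SE qE d0q ddq.
have q0 : 0 <= q by rewrite qE sumr_ge0.
have qS : q ^+ 2 <= 3 * S.
  rewrite qE SE !sum3E.
  rewrite -(real_normK (num_real (y 0))) -(real_normK (num_real (y 1))).
  rewrite -(real_normK (num_real (y 2%:R))).
  move: `|y 0| `|y 1| `|y 2%:R| => u v w.
  have := sqr_ge0 (u - v); have := sqr_ge0 (u - w); have := sqr_ge0 (v - w).
  nra.
have ddS : \sum_j 2 * y j * dd j <= 6 * q * (G * t ^- 2 * q + G * t ^- 3 * `|h|).
  rewrite qE mulr_sumr mulr_suml; apply: ler_sum => j _.
  apply: le_trans (ler_norm _) _; rewrite !normrM (ger0_norm (ler0n _ _)).
  rewrite -qE -mulrA; apply: le_trans (ler_wpM2l _ (ler_wpM2l _ (ddq j))) _ => //.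
  by rewrite le_eqVlt; apply/orP; left; apply/eqP; ring.
set Y := t * q; have Y0 : 0 <= Y by rewrite mulr_ge0// ltW.
have YS : Y ^+ 2 <= 3 * (t ^+ 2 * S).
  by rewrite exprMn [leRHS]mulrCA ler_wpM2l// sqr_ge0.
have E1 : t * (3 * t ^+ 2 * (6 * q * (G * t ^- 2 * q + G * t ^- 3 * `|h|))) =
    18 * (G / t) * (Y ^+ 2 + Y * `|h|).
  by rewrite /Y; field; rewrite gt_eqF.
(* After cancelling 6 t^2 S the right-hand side still contains 3 t^2 S >= Y^2 and 3 h^2. The bounds
   below spend 3/8 + 1/2 of Y^2 and 1/8 + 2 of h^2; the threshold 72 = 4 x 18 produces the
   coefficient 1/4. *)
have Gt : 18 * (G / t) <= 1 / 4.
  by rewrite mulrA ler_pdivrMr//; lra.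
have YH : Y * `|h| <= (Y ^+ 2 + h ^+ 2) / 2.
  rewrite -(real_normK (num_real h)); have := sqr_ge0 (Y - `|h|).
  by move: `|h| => H; nra.
have B1 : t * (3 * t ^+ 2 * (\sum_j 2 * y j * dd j)) <= 1 / 4 * (Y ^+ 2 + Y * `|h|).
  apply: (@le_trans _ _ (18 * (G / t) * (Y ^+ 2 + Y * `|h|))).
    by rewrite -E1 ler_wpM2l ?(ltW t0)// ler_wpM2l// mulr_ge0// sqr_ge0.
  by rewrite ler_wpM2r// addr_ge0 ?sqr_ge0// mulr_ge0.
have B2 : t * (2 * h * d0) <= 2 * (Y * `|h|).
  apply: le_trans (ler_norm _) _; rewrite !normrM (ger0_norm (ltW t0)).
  rewrite (ger0_norm (ler0n _ _)) /Y.
  have : t * (`|h| * `|d0|) <= t * (`|h| * q).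
    by rewrite ler_wpM2l ?(ltW t0)// ler_wpM2l.
  by lra.
have B3 : 2 * (Y * `|h|) <= 2 * h ^+ 2 + Y ^+ 2 / 2.
  rewrite -(real_normK (num_real h)); have := sqr_ge0 (Y - 2 * `|h|).
  by move: `|h| => H; nra.
have -> : t * (6 * t * S + 3 * t ^+ 2 * (\sum_j 2 * y j * dd j) + 2 * h * d0) =
  6 * (t ^+ 2 * S) + t * (3 * t ^+ 2 * (\sum_j 2 * y j * dd j)) + t * (2 * h * d0).
  by ring.
have S0 : 0 <= t ^+ 2 * S.
  by rewrite mulr_ge0 ?sqr_ge0// SE sumr_ge0// => j _; exact: sqr_ge0.
have h0 := sqr_ge0 h; rewrite -(mulrA 3 (t ^+ 2)); lra.
Qed.

(** Divided by t^3, the energy is nonincreasing along each ray, and compactness of the sphere of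
    radius [rho] bounds its initial value uniformly in the direction. Both conclusions are square
    roots of E = O(t^3). *)
Lemma gradient_growth_half : exists2 rho, r <= rho &
  (forall c, bigo (exterior rho) (1 / 2) (partials [:: c] f)) /\
  bigo (exterior rho) (3 / 2) f.
Proof.
have [G1 G10 HG] := bigo_uniform (fun i : 'I_3 * 'I_3 * 'I_3 => GamO i.1.1 i.1.2 i.2).
have [G2 G20 HP] := bigo_uniform (fun i : 'I_3 * 'I_3 => PO i.1 i.2).
pose G := G1 + G2; have G0 : 0 <= G by exact: addr_ge0.
have G1G : G1 <= G by rewrite lerDl.
have G2G : G2 <= G by rewrite lerDr.
(* The summand 2 r puts the sphere of radius [rho] inside the open domain; 72 G is the threshold of
   [energy_ineq]. *)
pose rho := 2 * r + 72 * G.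
have rrho : r < rho.
  have G720 : 0 <= 72 * G by rewrite mulr_ge0.
  by rewrite /rho; move: r0 G720; move: (72 * G) => ? ? ?; lra.
have Grho : 72 * G <= rho by rewrite /rho lerDr mulr_ge0// ltW.
clearbody G rho; have rho0 : 0 < rho by exact: lt_trans rrho.
have [|M0 M00 HM0] := @annulus_bounded R rho rho f.
  move=> x /andP[rx _]; apply: (smooth_continuous sf (s := [::])).
  exact: lt_le_trans rx.
have H k : exists2 C, 0 <= C & forall x, annulus rho rho x -> `|partials [:: k] f x| <= C.
  apply: annulus_bounded => x /andP[rx _]; apply: (smooth_continuous sf (s := [:: k])).
  exact: lt_le_trans rx.
have [M HM] : exists M, forall x, annulus rho rho x ->
    3 * (rho * rho) * (\sum_j partials [:: j] f x * partials [:: j] f x) + f x * f x <= M.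
  have [C0 _ HC0] := H 0; have [C1 _ HC1] := H 1; have [C2 _ HC2] := H 2%:R.
  exists (3 * (rho * rho) * (C0 * C0 + C1 * C1 + C2 * C2) + M0 * M0) => x Ax.
  have sq (u C : R) : `|u| <= C -> u * u <= C * C.
    by move=> uC; rewrite -[u * u]expr2 -real_normK ?num_real// expr2 ler_pM.
  rewrite sum3E; apply: lerD; last exact/sq/HM0.
  apply: ler_wpM2l; first by rewrite mulr_ge0 ?mulr_ge0 ?(ltW rho0).
  by apply: lerD; [apply: lerD|]; apply: sq; [exact: HC0|exact: HC1|exact: HC2].
have key x : exterior rho x -> 3 * (enorm x * enorm x) *
    (\sum_j partials [:: j] f x * partials [:: j] f x) + f x * f x <= M * enorm x ^+ 3.
  move=> rx; have s0 : 0 < enorm x by exact: lt_trans rx.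
  have th1 := enorm_ray_dir s0; set th := ray_dir x in th1.
  have xth : enorm x *: th = x by exact: ray_dirK.
  pose F j t := partials [:: j] f (t *: th).
  pose DF j t := \sum_k th 0 k * partials [:: k; j] f (t *: th).
  pose d0 t := \sum_k th 0 k * partials [:: k] f (t *: th).
  pose E t := 3 * (t * t) * (\sum_j F j t * F j t) + f (t *: th) * f (t *: th).
  pose dE t := (3 * (1 * t + t * 1)) * (\sum_j F j t * F j t) +
     3 * (t * t) * (\sum_j (DF j t * F j t + F j t * DF j t)) +
     (d0 t * f (t *: th) + f (t *: th) * d0 t).
  have ext u : rho <= u <= enorm x -> exterior r (u *: th).
    by move=> /andP[ru _]; apply: exterior_ray => //; exact: lt_le_trans ru.
  have lineD s u : rho <= u <= enorm x -> is_derive u 1 (fun t => partials s f (t *: th))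
      (\sum_k th 0 k * partials (k :: s) f (u *: th)).
    move=> /ext eu.
    have := @smooth_line R (exterior r) f (@exterior_open R r) sf s (0 : V) th u.
    by under eq_fun do rewrite add0r; rewrite add0r; exact.
  have dEE u : rho <= u <= enorm x -> is_derive u 1 E (dE u).
    move=> ru; apply: is_derive_fD.
      apply: is_derive_fM.
        by apply: is_derive_fZ; apply: is_derive_fM; exact: is_derive_id.
      by apply: is_derive_fsum => j; apply: is_derive_fM; exact: (lineD [:: j]).
    by apply: is_derive_fM; exact: (lineD [::]).
  have dG u : rho <= u <= enorm x -> is_derive u 1 (fun t => E t * t `^ (- 3))
     (dE u * u `^ (- 3) + E u * (- 3 * u `^ (- 3 - 1))).
    move=> ru; apply: is_derive_fM; first exact: dEE.
    by apply: is_derive1_powR; case/andP: ru => ru _; exact: lt_le_trans ru.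
  have := @derive_le0_ge R _ _ rho (enorm x) (ltW rx) dG.
  have rho3 : rho `^ (- 3) <= 1.
    rewrite -[leRHS](powRr0 rho).
    by apply: ler_powR; [exact: le_trans r1 (ltW rrho)|rewrite oppr_le0].
  have ErM : E rho <= M.
    apply: HM; rewrite /annulus/= enormZ th1 mulr1 ger0_norm ?lexx//; exact: ltW.
  have Er0 : 0 <= E rho.
    rewrite addr_ge0// -?expr2 ?sqr_ge0// mulr_ge0// ?mulr_ge0 ?(ltW rho0)//.
    by rewrite sumr_ge0// => j _; rewrite -expr2 sqr_ge0.
  have Ex : E (enorm x) = 3 * (enorm x * enorm x) *
    (\sum_j partials [:: j] f x * partials [:: j] f x) + f x * f x.
    by rewrite /E /F xth.
  rewrite -Ex => Hdec.
  suff : E (enorm x) * enorm x `^ (- 3) <= M.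
    by rewrite (powR_invn 3) ?(ltW s0)// ler_pdivrMr// exprn_gt0.
  apply: le_trans (Hdec _) _; last first.
    by apply: le_trans ErM; rewrite ler_piMr.
  move=> u ru; have u0 : 0 < u by case/andP: ru => ru _; exact: lt_le_trans ru.
  have nu : enorm (u *: th) = u by rewrite enormZ th1 mulr1 gtr0_norm.
  have -> : dE u * u `^ (- 3) + E u * (- 3 * u `^ (- 3 - 1)) =
     u `^ (- 3 - 1) * (u * dE u - 3 * E u).
    have -> : u `^ (- 3) = u * u `^ (- 3 - 1).
      by rewrite -{2}(powRr1 (ltW u0)) -powR_addE//; congr (_ `^ _); ring.
    ring.
  rewrite mulr_ge0_le0 ?powR_ge0// subr_le0.
  set q := \sum_j `|F j u|; set h := f (u *: th).
  have := @energy_ineq u (\sum_j F j u ^+ 2) q h (d0 u) G (F^~ u) (DF^~ u) u0 G0.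
  rewrite (_ : 6 * u * _ + _ + _ = dE u); last first.
    rewrite /dE; congr (_ + _ + _); last by rewrite -/h; ring.
      by congr (_ * _); ring.
    by congr (_ * _); apply: eq_bigr => j _; ring.
  rewrite (_ : 3 * u ^+ 2 * _ + _ = E u)//; apply=> //.
  - by case/andP: ru => ru _; exact: le_trans ru.
  - apply: le_trans (ler_norm_sum _ _ _) _; apply: ler_sum => k _.
    by rewrite normrM ler_piMl// -th1 coord_le_enorm.
  move=> j; apply: le_trans (@gradient_dot_le R (fun k => partials [:: k; j] f) th (u *: th)
    (G * u ^- 2 * q + G * u ^- 3 * `|h|) 1 _ _) _; last by rewrite mulr1.
    by move=> k; rewrite -th1 coord_le_enorm.
  move=> k; rewrite (fE _ _ (ext _ ru)).
  apply: le_trans (ler_normD _ _) _; apply: lerD.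
    apply: le_trans (ler_norm_sum _ _ _) _; rewrite /q mulr_sumr; apply: ler_sum => c _.
    rewrite normrM ler_wpM2r//; apply: le_trans (HG (c, k, j) _ (ext _ ru)) _.
    by rewrite nu (powR_invn 2) ?(ltW u0)// ler_wpM2r ?invr_ge0 ?exprn_ge0 ?(ltW u0).
  rewrite normrM ler_wpM2r//; apply: le_trans (HP (k, j) _ (ext _ ru)) _.
  by rewrite nu (powR_invn 3) ?(ltW u0)// ler_wpM2r ?invr_ge0 ?exprn_ge0 ?(ltW u0).
exists rho; first exact: ltW.
have M_ge0 : 0 <= `|M| by [].
have root p (u s : R) : 0 < s -> u * u <= `|M| * (s `^ p * s `^ p) ->
    `|u| <= Num.sqrt `|M| * s `^ p.
  move=> s0 H1; rewrite -(@ler_pXn2r _ 2)// ?nnegrE ?mulr_ge0 ?sqrtr_ge0 ?powR_ge0//.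
  by rewrite exprMn sqr_sqrtr// real_normK ?num_real// !expr2.
have keyM x : exterior rho x -> 3 * (enorm x * enorm x) *
    (\sum_j partials [:: j] f x * partials [:: j] f x) + f x * f x <= `|M| * enorm x ^+ 3.
  move=> rx; apply: le_trans (key x rx) _.
  by rewrite ler_wpM2r ?ler_norm// exprn_ge0// enorm_ge0.
split=> [c|]; apply: (@bigo_intro _ _ _ _ (Num.sqrt `|M|)) => x rx;
  have s0 : 0 < enorm x by exact: lt_trans rx.
  apply: root => //; rewrite -powR_addE// (_ : 1 / 2 + 1 / 2 = 1); last by field.
  rewrite powRr1 ?(ltW s0)//.
  have N0 : 0 < enorm x * enorm x by exact: mulr_gt0.
  rewrite -(ler_pM2r N0); have := keyM x rx; rewrite (bigD1 c)//=.
  have : 0 <= \sum_(i < 3 | i != c) partials [:: i] f x * partials [:: i] f x.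
    by rewrite sumr_ge0// => j _; rewrite -expr2 sqr_ge0.
  move: (\sum_(i < 3 | i != c) _) => W W0.
  have : 0 <= f x * f x by rewrite -expr2 sqr_ge0.
  have : 0 <= partials [:: c] f x * partials [:: c] f x by rewrite -expr2 sqr_ge0.
  move: (partials [:: c] f x * _) (f x * f x) => a b a0 b0.
  have := mulr_ge0 (ltW N0) W0; have := mulr_ge0 (ltW N0) a0.
  rewrite -(mulrA `|M|) (_ : enorm x * (enorm x * enorm x) = enorm x ^+ 3); last by ring.
  move: (enorm x * enorm x) (`|M| * enorm x ^+ 3) => N K; nra.
apply: root => //; rewrite -powR_addE// (_ : 3 / 2 + 3 / 2 = 3%:R); last by field.
rewrite powR_mulrn ?(ltW s0)//; apply: le_trans (keyM x rx); rewrite lerDr.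
rewrite mulr_ge0// ?mulr_ge0 ?(ltW s0)//.
by rewrite sumr_ge0// => j _; rewrite -expr2 sqr_ge0.
Qed.

End LinearSystem.

(** * Leading terms in the mass and the limit of the gradient *)

Section MassObstruction.
Context {R : realType}.
Notation V := 'rV[R]_3.
Implicit Types (i j k : 'I_3).

Lemma sum_delta j (G : 'I_3 -> R) : \sum_k (k == j)%:R * G k = G j.
Proof.
rewrite (bigD1 j)//= eqxx mul1r big1 ?addr0// => k /negbTE ->.
by rewrite mul0r.
Qed.

Variables (r m : R) (f : V -> R).
Variables (Gam : 'I_3 -> 'I_3 -> 'I_3 -> V -> R) (P : 'I_3 -> 'I_3 -> V -> R).

(* Leading parts of the Christoffel symbols and of the Ricci tensor of the
   Schwarzschild metric of mass [m]. *)
Definition gam_lead (c a b : 'I_3) (x : V) : R := - m * (enorm x)^-1 ^+ 3 *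
  (x 0 a * (b == c)%:R + x 0 b * (a == c)%:R - x 0 c * (a == b)%:R).

Definition ric_lead (a b : 'I_3) (x : V) : R := m * ((a == b)%:R * (enorm x)^-1 ^+ 3 -
  3 * x 0 a * x 0 b * (enorm x)^-1 ^+ 5).

Hypotheses (r1 : 1 <= r) (sf : smooth_on_open (exterior r) f).
Hypothesis fE : linear_hessian r f Gam P.
Hypothesis GamL : forall c a b,
  bigo (exterior r) (- 3) (fun x => Gam c a b x - gam_lead c a b x).
Hypothesis PL : forall a b, bigo (exterior r) (- 4) (fun x => P a b x - ric_lead a b x).

Let r0 : 0 < r. Proof. exact: lt_le_trans r1. Qed.
Let ext_pos t : r <= t -> forall x, exterior t x -> 0 < enorm (x : V).
Proof. by move=> rt x; apply: lt_trans; exact: lt_le_trans rt. Qed.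
Let ext_ge1 t : r <= t -> forall x, exterior t x -> 1 <= enorm (x : V).
Proof. by move=> rt x /ltW; apply: le_trans; exact: le_trans rt. Qed.

Lemma bigo_invn (A : set V) n : bigo A (- n%:R) (fun x => (enorm x)^-1 ^+ n).
Proof.
apply: bigo_ext (bigo_powR A _) => x _.
by rewrite powR_invn ?enorm_ge0// exprVn.
Qed.

Lemma gam_lead_bigo t c a b : r <= t -> bigo (exterior t) (- 2) (gam_lead c a b).
Proof.
move=> rt; apply: (@bigoM _ _ (- 3) 1).
- exact: ext_pos.
- by ring.
- by apply: bigoZ; exact: bigo_invn.
have H k (d : R) : bigo (exterior t) 1 (fun x => x 0 k * d).
  by apply: bigo_ext (bigoZ d (bigo_coord _ k)) => x _; rewrite mulrC.
by apply: bigoB; [apply: bigoD|].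
Qed.

Lemma ric_lead_bigo t a b : r <= t -> bigo (exterior t) (- 3) (ric_lead a b).
Proof.
move=> rt; apply: bigoZ; apply: bigoB.
  by apply: bigoZ; exact: bigo_invn.
apply: (@bigoM _ _ 2 (- 5)).
- exact: ext_pos.
- by ring.
- apply: (@bigoM _ _ 1 1); [exact: ext_pos|by ring| |exact: bigo_coord].
  by apply: bigoZ; exact: bigo_coord.
exact: bigo_invn.
Qed.

Let GamO c a b : bigo (exterior r) (- 2) (Gam c a b).
Proof.
apply: (bigo_perturb _ _ (GamL c a b)) (gam_lead_bigo c a b (lexx r)); first exact: ext_ge1.
by rewrite lerN2 ler_nat.
Qed.

Let PO a b : bigo (exterior r) (- 3) (P a b).
Proof.
apply: (bigo_perturb _ _ (PL a b)) (ric_lead_bigo a b (lexx r)); first exact: ext_ge1.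
by rewrite lerN2 ler_nat.
Qed.

(** The Hessian is O(|x|^(-3/2)), which is integrable at infinity. The radius is doubled twice, once
    for the limit of df and once for integrating df - a. *)
Lemma first_order_limit : exists2 rho, r <= rho & exists a : 'I_3 -> R,
  (forall c, bigo (exterior rho) (- (1 / 2)) (fun x => partials [:: c] f x - a c)) /\
  bigo (exterior rho) (1 / 2) (fun x => f x - \sum_k a k * x 0 k).
Proof.
have [rho rrho [df1 f1]] := gradient_growth_half r1 sf fE GamO PO.
have rho0 : 0 < rho by exact: lt_le_trans rrho.
have ddf a b : bigo (exterior rho) (- (1 / 2) - 1) (partials [:: a; b] f).
  apply: (hessian_bigo r1 fE GamO PO rrho) => [c|].
    by rewrite (_ : _ + 2 = 1 / 2)//; field.
  by rewrite (_ : _ + 3 = 3 / 2)//; field.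
have L c : exists L, bigo (exterior (2 * rho)) (- (1 / 2))
    (fun x => partials [:: c] f x - L).
  have [C C0 HC] := bigo_uniform (fun k => ddf k c).
  have G := smooth_has_gradient sf [:: c] rrho.
  by apply: (gradient_limit rho0 G _ HC) => //; lra.
have [a Ha] := choice L.
have rho2 : rho <= 2 * rho by rewrite ler_peMl ?ltW// ltr1n.
have rho4 : 2 * rho <= 2 * (2 * rho) by rewrite ler_pM2l.
exists (2 * (2 * rho)); first exact: le_trans (le_trans rrho rho2) rho4.
exists a; split=> [c|].
  by apply: bigo_sub (Ha c); exact: subset_exterior.
have [C C0 HC] := bigo_uniform Ha.
apply: (@gradient_growth _ _ _ (fun k x => partials [:: k] f x - a k) _ _ C) => //.
- by rewrite mulr_gt0.
- move=> x v ex.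
  have -> : \sum_k v 0 k * (partials [:: k] f x - a k) =
     \sum_k v 0 k * partials [:: k] f x - \sum_k a k * v 0 k.
    by rewrite -sumrB; apply: eq_bigr => k _; rewrite mulrBr [a k * _]mulrC.
  apply: is_derive_fB.
    by apply: (smooth_has_gradient sf [::] (t := 2 * rho)) => //; exact: le_trans rho2.
  apply: is_derive_fsum => k; apply: is_derive_fZ.
  exact: is_derive_coord.
- by move=> k x ex; have := HC k x ex; rewrite (_ : 1 / 2 - 1 = - (1 / 2))//; field.
- move=> x ex; apply: continuousB.
    suff cf : {for x, continuous (partials [::] f)} by [].
    by apply: (smooth_continuous sf); apply: subset_exterior ex; exact: le_trans rho2.
  by apply: continuous_fsum => k; apply: continuousM; [exact: cst_continuous|
    exact: coord_continuous].
Qed.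

End MassObstruction.

(** * The leading Hessian at test points of a coordinate plane *)

Section LeadingHessian.
Context {R : realType}.
Notation V := 'rV[R]_3.
Implicit Types (i j k : 'I_3) (a : 'I_3 -> R).

(* The Hessian that the leading terms prescribe for a function asymptotic to
   [a.x]. *)
Definition hess_lead (m : R) a i j (x : V) : R :=
  \sum_c gam_lead m c i j x * a c + ric_lead m i j x * (\sum_k a k * x 0 k).

(** With t = 1 or t = -1 and [l] varying, these are the two diagonal rays of the coordinate plane of
    [i] and [j]; with [l] fixed and t from -1 to 1 they run along the segment joining the rays. *)
Definition test_pt i j (l t : R) : V := l *: (axis j + t *: axis i).

Lemma test_ptE i j l t k : test_pt i j l t 0 k = l * ((k == j)%:R + t * (k == i)%:R).
Proof. by rewrite !mxE. Qed.

Lemma sqr_enorm_test_pt i j l t : i != j ->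
  enorm (test_pt i j l t) ^+ 2 = l ^+ 2 * (1 + t ^+ 2).
Proof.
move=> ij; rewrite sqr_enorm.
under eq_bigr do rewrite test_ptE.
rewrite (bigD1 j)//= (bigD1 i)//= big1 ?addr0; last first.
  by move=> k /andP[/negbTE-> /negbTE->]; rewrite mulr0 addr0 mulr0 expr0n.
by rewrite !eqxx (negbTE ij) [j == i]eq_sym (negbTE ij) /=; ring.
Qed.

Lemma test_pt_dot a i j l t : \sum_k a k * test_pt i j l t 0 k = l * (a j + t * a i).
Proof.
rewrite -(sum_delta j a) -(sum_delta i a) mulrDr !mulr_sumr -big_split/=.
by apply: eq_bigr => k _; rewrite test_ptE; ring.
Qed.

Lemma enorm_test_pt_bounds i j l t : i != j -> 0 < l -> `|t| <= 1 ->
  l <= enorm (test_pt i j l t) <= 2 * l.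
Proof.
move=> ij l0 t1; have E := sqr_enorm_test_pt l t ij.
have l20 : 0 <= l ^+ 2 by exact: sqr_ge0.
have t2 : t ^+ 2 <= 1 by rewrite -real_normK ?num_real// expr_le1.
rewrite -(@ler_pXn2r _ 2)// ?nnegrE ?enorm_ge0 ?(ltW l0)//.
rewrite -(@ler_pXn2r _ 2 _ _ (2 * l))// ?nnegrE ?enorm_ge0 ?mulr_ge0 ?(ltW l0)//.
rewrite E exprMn; have := sqr_ge0 t; move: (t ^+ 2) (l ^+ 2) t2 l20 => T L *.
by apply/andP; split; nra.
Qed.

Lemma gam_lead_sum m a p q x : \sum_c gam_lead m c p q x * a c =
  - m * (enorm x)^-1 ^+ 3 *
  (x 0 p * a q + x 0 q * a p - (p == q)%:R * (\sum_k a k * x 0 k)).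
Proof.
rewrite -(sum_delta p a) -(sum_delta q a) !mulr_sumr -big_split/= -sumrB mulr_sumr.
by apply: eq_bigr => c _; rewrite /gam_lead ![c == _]eq_sym; ring.
Qed.

(** The part of the bracket that is odd in t carries [a j]; the even part is -(1 + 3 t^2 / (1 +
    t^2)) times [a i] and never changes sign. Adding the values at t and -t therefore isolates
    [a i]. *)
Lemma hess_lead_offdiag m a i j l t : i != j -> 0 < l ->
  hess_lead m a i j (test_pt i j l t) = m * (enorm (test_pt i j l t))^-1 ^+ 3 * l *
   (- t * a j - a i - 3 * t * (a j + t * a i) / (1 + t ^+ 2)).
Proof.
move=> ij l0; rewrite /hess_lead gam_lead_sum /ric_lead (negbTE ij).
have E : (enorm (test_pt i j l t))^-1 ^+ 5 =
   (enorm (test_pt i j l t))^-1 ^+ 3 / (l ^+ 2 * (1 + t ^+ 2)).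
  by rewrite -(sqr_enorm_test_pt _ _ ij) -exprVn -exprD.
rewrite E test_pt_dot !test_ptE !eqxx (negbTE ij) [j == i]eq_sym (negbTE ij).
move: (_^-1 ^+ 3) => u /=; field.
by rewrite (gt_eqF l0) /= gt_eqF// ltr_pwDl// sqr_ge0.
Qed.

Lemma hess_lead_diag m a i j l t : i != j -> 0 < l ->
  hess_lead m a j j (test_pt i j l t) = m * (enorm (test_pt i j l t))^-1 ^+ 3 * l *
   (2 * t * a i - 3 * (a j + t * a i) / (1 + t ^+ 2)).
Proof.
move=> ij l0; rewrite /hess_lead gam_lead_sum /ric_lead eqxx.
have E : (enorm (test_pt i j l t))^-1 ^+ 5 =
   (enorm (test_pt i j l t))^-1 ^+ 3 / (l ^+ 2 * (1 + t ^+ 2)).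
  by rewrite -(sqr_enorm_test_pt _ _ ij) -exprVn -exprD.
rewrite E test_pt_dot !test_ptE !eqxx [j == i]eq_sym (negbTE ij).
move: (_^-1 ^+ 3) => u /=; field.
by rewrite (gt_eqF l0) /= gt_eqF// ltr_pwDl// sqr_ge0.
Qed.

End LeadingHessian.

(** * The limit of the gradient vanishes *)

Section LimitGradient.
Context {R : realType}.
Notation V := 'rV[R]_3.
Implicit Types (i j k : 'I_3).

Lemma enorm_test_ptN i j (l t : R) : i != j ->
  enorm (test_pt i j l (- t)) = enorm (test_pt i j l t).
Proof.
by move=> ij; apply: (@pexpIrn R 2) => //; rewrite ?nnegrE ?enorm_ge0//
  !sqr_enorm_test_pt// sqrrN.
Qed.

Lemma sum_axis i (c : R) (G : 'I_3 -> R) : \sum_k (c *: axis i : V) 0 k * G k = c * G i.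
Proof.
rewrite -(sum_delta i G) mulr_sumr; apply: eq_bigr => k _.
by rewrite mxE axisE mulrA.
Qed.

Lemma sum_axisD i j (c : R) (G : 'I_3 -> R) :
  \sum_k (axis j + c *: axis i : V) 0 k * G k = G j + c * G i.
Proof.
rewrite -(sum_delta i G) -(sum_delta j G) mulr_sumr -big_split/=.
by apply: eq_bigr => k _; rewrite !mxE/=; ring.
Qed.

Variables (r m : R) (f : V -> R).
Variables (Gam : 'I_3 -> 'I_3 -> 'I_3 -> V -> R) (P : 'I_3 -> 'I_3 -> V -> R).
Hypotheses (r1 : 1 <= r) (sf : smooth_on_open (exterior r) f).
Hypothesis fE : linear_hessian r f Gam P.
Hypothesis GamL : forall c a b,
  bigo (exterior r) (- 3) (fun x => Gam c a b x - gam_lead m c a b x).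
Hypothesis PL : forall a b, bigo (exterior r) (- 4) (fun x => P a b x - ric_lead m a b x).

Variable (a : 'I_3 -> R).
Hypothesis df_lim : forall c, bigo (exterior r) (- (1 / 2)) (fun x => partials [:: c] f x - a c).
Hypothesis f_lim : bigo (exterior r) (1 / 2) (fun x => f x - \sum_k a k * x 0 k).

Let r0 : 0 < r. Proof. exact: lt_le_trans r1. Qed.
Let ext_pos x : exterior r x -> 0 < enorm (x : V).
Proof. exact: lt_trans. Qed.
Let ext_ge1 x : exterior r x -> 1 <= enorm (x : V).
Proof. by move=> /ltW; apply: le_trans. Qed.

(** Replacing the coefficients by their leading parts costs O(|x|^(-3)); replacing df by [a] and f
    by a.x costs O(|x|^(-5/2)). Both are smaller than the leading part, of order |x|^(-2), if that
    part is nonzero. *)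
Lemma hess_lead_error i j :
  bigo (exterior r) (- (5 / 2)) (fun x => partials [:: i; j] f x - hess_lead m a i j x).
Proof.
have dfO c : bigo (exterior r) 0 (partials [:: c] f).
  by apply: (bigo_perturb ext_ge1 _ (df_lim c)) (bigo_cst _ (a c)); lra.
have fO : bigo (exterior r) 1 f.
  have lin : bigo (exterior r) 1 (fun x => \sum_k a k * x 0 k).
    by apply: bigo_fsum => k; apply: bigoZ; exact: bigo_coord.
  by apply: (bigo_perturb ext_ge1 _ f_lim) lin; lra.
have T1 : bigo (exterior r) (- (5 / 2))
    (fun x => \sum_c (Gam c i j x - gam_lead m c i j x) * partials [:: c] f x).
  apply: (bigo_weak ext_ge1 (_ : - 3 <= _)); first by lra.
  by apply: bigo_fsum => c; apply: (bigoM ext_pos _ (GamL c i j) (dfO c)); rewrite addr0.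
have T2 : bigo (exterior r) (- (5 / 2))
    (fun x => \sum_c gam_lead m c i j x * (partials [:: c] f x - a c)).
  apply: bigo_fsum => c.
  by apply: (bigoM ext_pos _ (gam_lead_bigo m r1 c i j (lexx r)) (df_lim c)); field.
have T3 : bigo (exterior r) (- (5 / 2)) (fun x => (P i j x - ric_lead m i j x) * f x).
  apply: (bigo_weak ext_ge1 (_ : - 3 <= _)); first by lra.
  by apply: (bigoM ext_pos _ (PL i j) fO); ring.
have T4 : bigo (exterior r) (- (5 / 2))
    (fun x => ric_lead m i j x * (f x - \sum_k a k * x 0 k)).
  by apply: (bigoM ext_pos _ (ric_lead_bigo m r1 i j (lexx r)) f_lim); field.
apply: bigo_ext (bigoD (bigoD T1 T2) (bigoD T3 T4)) => x rx.
rewrite (fE _ _ rx) /hess_lead.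
set Y := \sum_k a k * x 0 k.
have -> : \sum_c Gam c i j x * partials [:: c] f x =
    \sum_c (Gam c i j x - gam_lead m c i j x) * partials [:: c] f x +
    \sum_c gam_lead m c i j x * (partials [:: c] f x - a c) +
    \sum_c gam_lead m c i j x * a c.
  by rewrite -!big_split/=; apply: eq_bigr => c _; ring.
ring.
Qed.

(** The coefficients are those of the leading Hessian at t = 1 and t = -1. Those of [aj] cancel and
    those of [ai] add up to -4, so the sum is at most twice the left side of the first
    hypothesis. *)
Let diagonal_sum_le0 (Q ai aj s X1 X2 X3 X4 e : R) :
  - 2 * (Q * ai) + 2 * e < 0 ->
  s * X1 <= Q * (1 / 2 * ai - 3 / 2 * aj) + e ->
  s * X2 <= Q * (- (5 / 2) * ai - 5 / 2 * aj) + e ->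
  s * - X3 <= Q * (1 / 2 * ai + 3 / 2 * aj) + e ->
  s * X4 <= Q * (- (5 / 2) * ai + 5 / 2 * aj) + e ->
  s * (X1 + X2 - (X3 - X4)) <= 0.
Proof.
have -> : s * (X1 + X2 - (X3 - X4)) = s * X1 + s * X2 + s * - X3 + s * X4 by ring.
move: (s * X1) (s * X2) (s * - X3) (s * X4) => x1 x2 x3 x4 *; lra.
Qed.

(** [D] is the part odd in t, which cancels; [A] comes from 3 t^2 / (1 + t^2) and has a favourable
    sign. *)
Let offdiagonal_sum_lt0 (A B D e x1 x2 : R) : - 2 * B + 2 * e < 0 ->
  x1 <= - A - B - D + e -> x2 <= - A - B + D + e -> 0 <= A -> x1 + x2 < 0.
Proof. by move=> *; lra. Qed.

(** Let chi be the difference of d_j f between the two diagonal rays. Both ways of computing it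
    involve [a i] only, since [a j] cancels by the symmetry t -> -t. Multiplying by s = m a_i turns
    the leading terms into negative multiples of s^2, and these dominate the errors far out. *)
Lemma limit_gradient_zero : m != 0 -> forall i, a i = 0.
Proof.
move=> m0 i; apply/eqP; apply: contraT => ai0.
pose s := m * a i; have s0 : s != 0 by rewrite mulf_neq0.
have s2 : 0 < s ^+ 2 by rewrite exprn_even_gt0.
have [j ij] : exists j, i != j.
  by have [->|?] := eqVneq i 0; [exists 1|exists 0].
have [C C0 HC] := bigo_uniform (fun p : 'I_3 * 'I_3 => hess_lead_error p.1 p.2).
have [C1 C10 HC1] := bigo_uniform df_lim.
pose S := `|s|; have S0 : 0 <= S by exact: normr_ge0.
have SC : 0 < 4 * S * C + 1 by rewrite ltr_wpDl// !mulr_ge0.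
(* Beyond [L] the error, smaller by |x|^(-1/2), is dominated by the leading term s^2. In [far] the
   bound N <= 2 l is also used, to replace l N^(-3) by N^(-2) / 2; the added 1 avoids a zero
   denominator. *)
have [L L0 HL] := @powR_small R (- (1 / 2)) (s ^+ 2 / (4 * S * C + 1)) ltac:(lra)
  ltac:(by rewrite divr_gt0).
pose l0 := L + r.
have far l t : l0 <= l -> `|t| <= 1 -> [/\ 0 < l, exterior r (test_pt i j l t) &
   - 2 * ((enorm (test_pt i j l t))^-1 ^+ 3 * l) * s ^+ 2 +
   2 * (S * (C * enorm (test_pt i j l t) `^ (- (5 / 2)))) < 0].
  move=> ll t1; have lP : 0 < l by apply: lt_le_trans ll; rewrite addr_gt0.
  have /andP[N1 N2] := enorm_test_pt_bounds ij lP t1.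
  have NP : 0 < enorm (test_pt i j l t) by exact: lt_le_trans N1.
  split=> //.
    by apply: lt_le_trans N1; apply: lt_le_trans ll; rewrite ltr_pwDl.
  have := HL (enorm (test_pt i j l t)) (le_trans _ N1).
  move=> /(_ (le_trans _ ll)); rewrite lerDl => /(_ (ltW r0)).
  rewrite (_ : - (5 / 2) = - 2%:R + - (1 / 2)); last by field.
  rewrite powR_addE// powR_invn ?(ltW NP)//.
  move: (enorm _) NP N2 => N NP N2; move: (N `^ _) => h hN.
  have N2P : 0 < N ^- 2 by rewrite invr_gt0 exprn_gt0.
  have lN : 1 / 2 * N ^- 2 <= N^-1 ^+ 3 * l.
    have -> : N^-1 ^+ 3 * l = N ^- 2 * (l / N) by field; rewrite gt_eqF.
    by rewrite [leLHS]mulrC ler_pM2l// ler_pdivlMr//; lra.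
  have h2 : 4 * S * C * h < s ^+ 2.
    apply: (@le_lt_trans _ _ (4 * S * C * (s ^+ 2 / (4 * S * C + 1)))).
      by rewrite ler_wpM2l// !mulr_ge0.
    by rewrite mulrCA gtr_pMr// ltr_pdivrMr// mul1r ltrDl.
  have lN2 : 1 / 2 * N ^- 2 * s ^+ 2 <= N^-1 ^+ 3 * l * s ^+ 2 by rewrite ler_pM2r.
  have h3 : N ^- 2 * (4 * S * C * h) < N ^- 2 * s ^+ 2 by rewrite ltr_pM2l.
  have -> : 2 * (S * (C * (N ^- 2 * h))) = 1 / 2 * (N ^- 2 * (4 * S * C * h)).
    by field; rewrite gt_eqF.
  have -> : - 2 * (N^-1 ^+ 3 * l) * s ^+ 2 = - 2 * (N^-1 ^+ 3 * l * s ^+ 2) by ring.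
  rewrite -mulrA in lN2; have A0 := mulr_gt0 N2P s2; move: A0 lN2 h3.
  move: (N ^- 2 * s ^+ 2) (_ * l * _) (_ * (_ * h)) => A B D *; lra.
have err p q x : exterior r x -> s * partials [:: p; q] f x <=
   s * hess_lead m a p q x + S * (C * enorm x `^ (- (5 / 2))).
  move=> rx; rewrite -lerBlDl -mulrBr; apply: le_trans (ler_norm _) _.
  by rewrite normrM ler_wpM2l//; exact: (HC (p, q)).
have errN p q x : exterior r x -> s * - partials [:: p; q] f x <=
   s * - hess_lead m a p q x + S * (C * enorm x `^ (- (5 / 2))).
  move=> rx; rewrite -lerBlDl -mulrBr; apply: le_trans (ler_norm _) _.
  by rewrite -opprD normrM normrN ler_wpM2l//; exact: (HC (p, q)).
(* [s chi] decreases to 0 along the two diagonal rays, so [s chi >= 0]; integrating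
   along the segment joining their points gives [s chi < 0]. *)
pose chi l := partials [:: j] f (test_pt i j l 1) - partials [:: j] f (test_pt i j l (- 1)).
have n1 : `|1 : R| <= 1 by rewrite normr1.
have nN1 : `|- 1 : R| <= 1 by rewrite normrN1.
have chi_pos : 0 <= s * chi l0.
  pose dchi l := (partials [:: j; j] f (test_pt i j l 1) + partials [:: i; j] f (test_pt i j l 1))
     - (partials [:: j; j] f (test_pt i j l (- 1)) - partials [:: i; j] f (test_pt i j l (- 1))).
  have dline (e l : R) : exterior r (test_pt i j l e) ->
      is_derive l 1 (fun l => partials [:: j] f (test_pt i j l e))
       (partials [:: j; j] f (test_pt i j l e) + e * partials [:: i; j] f (test_pt i j l e)).
    move=> ex; have := @smooth_line R _ f (@exterior_open R r) sf [:: j] 0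
      (axis j + e *: axis i) l.
    rewrite add0r => /(_ ex); under eq_fun do rewrite add0r.
    by rewrite sum_axisD.
  have dchiE l : l0 <= l -> is_derive l 1 (fun l => s * chi l) (s * dchi l).
    move=> ll; apply: is_derive_fZ.
    have [_ e1 _] := far l 1 ll n1; have [_ e2 _] := far l (- 1) ll nN1.
    by apply: is_derive_fB; [have := dline 1 l e1; rewrite mul1r|
      have := dline (- 1) l e2; rewrite mulN1r].
  have dchi_le0 l : l0 <= l -> s * dchi l <= 0.
    move=> ll; have [lP e1 neg] := far l 1 ll n1; have [_ e2 _] := far l (- 1) ll nN1.
    have A1 := err j j _ e1; have A2 := err i j _ e1.
    have A3 := errN j j _ e2; have A4 := err i j _ e2.
    rewrite !(enorm_test_ptN _ _ ij) in A3 A4.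
    rewrite !hess_lead_diag// !hess_lead_offdiag// !(enorm_test_ptN _ _ ij) in A1 A2 A3 A4.
    rewrite /dchi; move: neg A1 A2 A3 A4.
    move: (enorm _)^-1 (C * _) => u E neg.
    have -> : s * (m * u ^+ 3 * l * (2 * 1 * a i - 3 * (a j + 1 * a i) / (1 + 1 ^+ 2))) =
      u ^+ 3 * l * (s * m) * (1 / 2 * a i - 3 / 2 * a j) by field.
    have -> : s * (m * u ^+ 3 * l * (- 1 * a j - a i - 3 * 1 * (a j + 1 * a i) / (1 + 1 ^+ 2))) =
      u ^+ 3 * l * (s * m) * (- (5 / 2) * a i - 5 / 2 * a j) by field.
    have -> : s * - (m * u ^+ 3 * l * (2 * -1 * a i - 3 * (a j + -1 * a i) / (1 + (-1) ^+ 2))) =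
      u ^+ 3 * l * (s * m) * (1 / 2 * a i + 3 / 2 * a j) by field.
    have -> : s * (m * u ^+ 3 * l * (- -1 * a j - a i - 3 * -1 * (a j + -1 * a i) / (1 + (-1) ^+ 2))) =
      u ^+ 3 * l * (s * m) * (- (5 / 2) * a i + 5 / 2 * a j) by field.
    move=> A1 A2 A3 A4.
    have Eneg : - 2 * (u ^+ 3 * l) * s ^+ 2 = - 2 * (u ^+ 3 * l * (s * m) * a i).
      by rewrite /s; ring.
    rewrite Eneg in neg; exact: diagonal_sum_le0 neg A1 A2 A3 A4.
  (* The limit of [chi] is 0 because both values of d_j f tend to the same [a j]. *)
  apply: (@le_of_powR_decay _ (- (1 / 2)) _ _ (S * (C1 * 2 * 2)) l0); first by lra.
  move=> l ll.
  have D : s * chi l <= s * chi l0.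
    apply: (@derive_le0_ge R (fun l => s * chi l) (fun l => s * dchi l)) => // w /andP[w1 _].
      exact: dchiE.
    exact: dchi_le0.
  have [lP e1 _] := far l 1 ll n1; have [_ e2 _] := far l (- 1) ll nN1.
  have B1 := HC1 j _ e1; have B2 := HC1 j _ e2.
  rewrite (enorm_test_ptN _ _ ij) in B2.
  have /andP[N1 _] := enorm_test_pt_bounds ij lP n1.
  have Np : enorm (test_pt i j l 1) `^ (- (1 / 2)) <= l `^ (- (1 / 2)).
    by apply: powR_le0_anti => //; lra.
  have B3 : `|chi l| <= C1 * 2 * l `^ (- (1 / 2)).
    rewrite /chi (_ : _ - _ = (partials [:: j] f (test_pt i j l 1) - a j)
      - (partials [:: j] f (test_pt i j l (- 1)) - a j)); last by ring.
    apply: le_trans (ler_normB _ _) _.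
    have := ler_wpM2l C10 Np; move: B1 B2.
    by move: `|_| `|_| (_ `^ _) (_ `^ _) => *; lra.
  have B4 : - (s * chi l) <= S * (C1 * 2 * l `^ (- (1 / 2))).
    by apply: le_trans (ler_norm _) _; rewrite normrN normrM ler_wpM2l.
  have B5 : 0 <= S * (C1 * 2 * l `^ (- (1 / 2))) by rewrite !mulr_ge0 ?powR_ge0.
  have -> : S * (C1 * 2 * 2) * l `^ (- (1 / 2)) = 2 * (S * (C1 * 2 * l `^ (- (1 / 2)))) by ring.
  lra.
suff : s * chi l0 < 0 by rewrite ltNge chi_pos.
pose psi t := partials [:: j] f (test_pt i j l0 t) - partials [:: j] f (test_pt i j l0 (- t)).
pose dpsi t := l0 * partials [:: i; j] f (test_pt i j l0 t)
   + l0 * partials [:: i; j] f (test_pt i j l0 (- t)).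
have dseg (e t : R) : exterior r (test_pt i j l0 (e * t)) ->
    is_derive t 1 (fun t => partials [:: j] f (test_pt i j l0 (e * t)))
     (e * l0 * partials [:: i; j] f (test_pt i j l0 (e * t))).
  have E u : test_pt i j l0 (e * u) = l0 *: axis j + u *: ((e * l0) *: axis i) :> V.
    by rewrite /test_pt scalerDr !scalerA; congr (_ + _ *: _); ring.
  under eq_fun do rewrite E.
  rewrite E => ex; have := smooth_line (@exterior_open R r) sf [:: j] ex.
  by rewrite sum_axis.
have dpsiE (t : R) : 0 <= t <= 1 -> is_derive t 1 (fun t => s * psi t) (s * dpsi t).
  move=> /andP[ta tb]; have tn : `|t| <= 1 by rewrite ger0_norm.
  have ntn : `|- t| <= 1 by rewrite normrN.
  have [_ e1 _] := far l0 t (lexx _) tn; have [_ e2 _] := far l0 (- t) (lexx _) ntn.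
  have D1 := dseg 1 t; rewrite mul1r in D1; move/(_ e1) in D1.
  have D2 := dseg (- 1) t; rewrite mulN1r in D2; move/(_ e2) in D2.
  have D := is_derive_fZ s (is_derive_fB D1 D2).
  have E1 : (fun u : R => s * (partials [:: j] f (test_pt i j l0 (1 * u)) -
      partials [:: j] f (test_pt i j l0 (-1 * u)))) = (fun u => s * psi u).
    by apply/funext => u; rewrite mul1r mulN1r.
  have E2 : s * (1 * l0 * partials [:: i; j] f (test_pt i j l0 t) -
      -1 * l0 * partials [:: i; j] f (test_pt i j l0 (- t))) = s * dpsi t.
    by rewrite mul1r mulN1r mulNr opprK.
  by rewrite -E1 -E2.
have [t t01 E] := mean_value ler01 dpsiE.
(* At t = 0 the two test points coincide, so [psi] vanishes there, while [psi 1] is [chi l0]. *)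
have -> : s * chi l0 = s * psi 1 - s * psi 0 by rewrite {2}/psi oppr0 subrr mulr0 subr0.
rewrite E subr0 mulr1; case/andP: t01 => ta tb.
have tn : `|t| <= 1 by rewrite ger0_norm.
have ntn : `|- t| <= 1 by rewrite normrN.
have [lP e1 neg] := far l0 t (lexx _) tn; have [_ e2 _] := far l0 (- t) (lexx _) ntn.
have A1 := err i j _ e1; have A2 := err i j _ e2.
rewrite !hess_lead_offdiag// !(enorm_test_ptN _ _ ij) in A1 A2.
rewrite /dpsi -mulrDr mulrCA pmulr_rlt0// mulrDr.
have t2 : 0 < 1 + t ^+ 2 by rewrite ltr_pwDl// sqr_ge0.
have W0 : 0 <= (enorm (test_pt i j l0 t))^-1 ^+ 3 * l0 * s ^+ 2 * (3 * t ^+ 2 / (1 + t ^+ 2)).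
  apply: mulr_ge0; last by rewrite divr_ge0 ?(ltW t2)// mulr_ge0// sqr_ge0.
  apply: mulr_ge0; last exact: sqr_ge0.
  by apply: mulr_ge0; [rewrite exprn_ge0// invr_ge0 enorm_ge0|exact: ltW].
move: neg A1 A2 W0; move: (enorm _)^-1 (C * _) => u E' neg.
have -> : s * (m * u ^+ 3 * l0 * (- t * a j - a i - 3 * t * (a j + t * a i) / (1 + t ^+ 2))) =
   - (u ^+ 3 * l0 * s ^+ 2 * (3 * t ^+ 2 / (1 + t ^+ 2))) - u ^+ 3 * l0 * s ^+ 2
   - u ^+ 3 * l0 * (s * m) * (t * a j + 3 * t * a j / (1 + t ^+ 2)).
  by rewrite /s; field; rewrite gt_eqF.
have -> : s * (m * u ^+ 3 * l0 * (- - t * a j - a i - 3 * - t * (a j + - t * a i) /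
   (1 + (- t) ^+ 2))) =
   - (u ^+ 3 * l0 * s ^+ 2 * (3 * t ^+ 2 / (1 + t ^+ 2))) - u ^+ 3 * l0 * s ^+ 2
   + u ^+ 3 * l0 * (s * m) * (t * a j + 3 * t * a j / (1 + t ^+ 2)).
  by rewrite /s sqrrN; field; rewrite gt_eqF.
rewrite -mulrA in neg => A1 A2 W0; exact: offdiagonal_sum_lt0 neg A1 A2 W0.
Qed.

End LimitGradient.

(** * Solutions tending to zero vanish near infinity *)

Section AsymptoticValue.
Context {R : realType}.
Notation V := 'rV[R]_3.
Implicit Types (i j k : 'I_3).

Lemma le0_of_halving (x K : R) : (forall n, x <= K * (1 / 2) ^+ n) -> x <= 0.
Proof.
move=> H; rewrite leNgt; apply/negP => x0.
have K0 : 0 <= K / x.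
  by rewrite divr_ge0 ?(ltW x0)//; have := H 0%N; rewrite expr0 mulr1; apply: le_trans; exact: ltW.
have := H (Num.bound (K / x)); apply/negP; rewrite -ltNge.
rewrite expr_div_n expr1n mulrA mulr1 ltr_pdivrMr ?exprn_gt0// mulrC -ltr_pdivrMr//.
apply: lt_trans (archi_boundP K0) _.
by rewrite -natrX ltr_nat ltn_expl.
Qed.

Lemma smooth_on_open_sub (U W : set V) (F : V -> R) : U `<=` W ->
  smooth_on_open W F -> smooth_on_open U F.
Proof. by move=> UW sF s x /UW; exact: sF. Qed.

Variables (r m : R) (f : V -> R).
Variables (Gam : 'I_3 -> 'I_3 -> 'I_3 -> V -> R) (P : 'I_3 -> 'I_3 -> V -> R).
Hypotheses (r1 : 1 <= r) (sf : smooth_on_open (exterior r) f).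
Hypothesis fE : linear_hessian r f Gam P.
Hypothesis GamO : forall c a b, bigo (exterior r) (- 2) (Gam c a b).
Hypothesis PO : forall a b, bigo (exterior r) (- 3) (P a b).

Let r0 : 0 < r. Proof. exact: lt_le_trans r1. Qed.

(** If |df| <= K |x|^(-3/2), integration from infinity gives |f| <= 6 K |x|^(-1/2), and the system
    bounds the Hessian by 9 G K |x|^(-7/2). For |x| >= 36 G this is at most (K / 4) |x|^(-5/2), and
    a second integration returns the bound on df with K / 2. The domain does not depend on [K], so
    the halving can be iterated. *)
Lemma vanishing_limit_zero : bigo (exterior r) (- (1 / 2)) f ->
  (forall c, bigo (exterior r) (- (3 / 2)) (partials [:: c] f)) ->
  exists2 rho, r <= rho & forall x, exterior rho x -> f x = 0.
Proof.
move=> fO dfO.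
have [G1 G10 HG] := bigo_uniform (fun i : 'I_3 * 'I_3 * 'I_3 => GamO i.1.1 i.1.2 i.2).
have [G2 G20 HP] := bigo_uniform (fun i : 'I_3 * 'I_3 => PO i.1 i.2).
have [K0 K00 HK0] := bigo_uniform dfO.
have [C0 C00 HC0] := fO.
pose G := G1 + G2; have G0 : 0 <= G by exact: addr_ge0.
have G1G : G1 <= G by rewrite lerDl.
have G2G : G2 <= G by rewrite lerDr.
(* 36 = 4 x 9: the factor 9 = 3 + 6 collects the terms in df and in f, and 4 leaves K / 2 after
   integration. *)
pose rho := r + 36 * G.
have rrho : r <= rho by rewrite lerDl mulr_ge0.
have Grho : 36 * G <= rho by rewrite lerDr ltW.
clearbody G rho.
have rho0 : 0 < rho by exact: lt_le_trans rrho.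
have sub := subset_exterior rrho.
have decay0 K : 0 <= K ->
    (forall k x, exterior rho x -> `|partials [:: k] f x| <= K * enorm x `^ (- (3 / 2))) ->
    forall x, exterior rho x -> `|f x| <= 6 * K * enorm x `^ (- (1 / 2)).
  move=> K1 HK x rx.
  have gf := smooth_has_gradient sf [::] rrho.
  have HK' k y : exterior rho y -> `|partials [:: k] f y| <= K * enorm y `^ (- (1 / 2) - 1).
    by move=> ry; rewrite (_ : - (1 / 2) - 1 = - (3 / 2)); [exact: HK|field].
  have := gradient_decay rho0 gf _ HK' (q := - (1 / 2)) (C1 := C0) _ _ _ _ rx.
  rewrite (_ : 3 * K / - - (1 / 2) = 6 * K); last by field.
  apply; [by lra|by lra|by []|by lra|].
  by move=> y ry; apply: HC0; exact: sub.
have step K : 0 <= K ->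
    (forall k x, exterior rho x -> `|partials [:: k] f x| <= K * enorm x `^ (- (3 / 2))) ->
    forall k x, exterior rho x -> `|partials [:: k] f x| <= K * (1 / 2) * enorm x `^ (- (3 / 2)).
  move=> K1 HK c x rx.
  have gf := smooth_has_gradient sf [:: c] rrho.
  have H2 k y : exterior rho y ->
      `|partials [:: k; c] f y| <= K / 4 * enorm y `^ (- (3 / 2) - 1).
    move=> ry; have y0 : 0 < enorm y by exact: lt_trans ry.
    rewrite (fE _ _ (sub _ ry)).
    have B1 : `|\sum_d Gam d k c y * partials [:: d] f y| <=
        3 * (G * K) * enorm y `^ (- (7 / 2)).
      apply: le_trans (ler_norm_sum _ _ _) _.
      apply: (@le_trans _ _ (\sum_(d < 3) G * K * enorm y `^ (- (7 / 2)))).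
        apply: ler_sum => d _; rewrite normrM (_ : - (7 / 2) = - 2 + - (3 / 2)); last by field.
        rewrite powR_addE// mulrACA; apply: ler_pM => //; last exact: HK.
        by apply: le_trans (HG (d, k, c) _ (sub _ ry)) _; rewrite ler_wpM2r ?powR_ge0.
      by rewrite sumr_const card_ord -[leLHS]mulr_natl mulrA.
    have B2 : `|P k c y * f y| <= 6 * (G * K) * enorm y `^ (- (7 / 2)).
      rewrite normrM (_ : - (7 / 2) = - 3 + - (1 / 2)); last by field.
      rewrite powR_addE// (_ : 6 * (G * K) = G * (6 * K)); last by ring.
      rewrite mulrACA; apply: ler_pM => //; last exact: decay0.
      by apply: le_trans (HP (k, c) _ (sub _ ry)) _; rewrite ler_wpM2r ?powR_ge0.
    apply: le_trans (ler_normD _ _) _; apply: le_trans (lerD B1 B2) _.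
    rewrite -mulrDl (_ : - (7 / 2) = - 1 + (- (3 / 2) - 1)); last by field.
    rewrite powR_addE// [leLHS]mulrA ler_wpM2r ?powR_ge0// powR_inv1 ?(ltW y0)//.
    rewrite ler_pdivrMr//; have ry' : rho < enorm y by exact: ry.
    have Gy : 36 * G <= enorm y by exact: le_trans Grho (ltW ry').
    have := ler_wpM2l K1 Gy; move: (enorm y) => N *; lra.
  have := gradient_decay rho0 gf _ H2 (q := - (3 / 2)) (C1 := K0) _ _ _ _ rx.
  rewrite (_ : 3 * (K / 4) / - - (3 / 2) = K * (1 / 2)); last by field.
  apply; [by lra|by lra|by rewrite divr_ge0|by lra|].
  by move=> y ry; apply: HK0; exact: sub.
have iter n : forall k x, exterior rho x ->
    `|partials [:: k] f x| <= K0 * (1 / 2) ^+ n * enorm x `^ (- (3 / 2)).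
  elim: n => [|n IH] k x rx; first by rewrite expr0 mulr1; exact: HK0 (sub _ rx).
  rewrite exprSr (mulrA K0); apply: step => //.
  by rewrite mulr_ge0// exprn_ge0.
have df0 k x : exterior rho x -> `|partials [:: k] f x| <= 0 * enorm x `^ (- (3 / 2)).
  move=> rx; rewrite mul0r; apply: (@le0_of_halving _ (K0 * enorm x `^ (- (3 / 2)))) => n.
  by rewrite mulrAC; exact: iter.
exists rho => // x rx; apply/eqP; rewrite -normr_le0.
by apply: le_trans (decay0 _ (lexx _) df0 _ rx) _; rewrite mulr0 mul0r.
Qed.

End AsymptoticValue.

Section Trichotomy.
Context {R : realType}.
Notation V := 'rV[R]_3.
Variables (r m : R) (f : V -> R).
Variables (Gam : 'I_3 -> 'I_3 -> 'I_3 -> V -> R) (P : 'I_3 -> 'I_3 -> V -> R).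
Hypotheses (m0 : m != 0) (r1 : 1 <= r) (sf : smooth_on_open (exterior r) f).
Hypothesis fE : linear_hessian r f Gam P.
Hypothesis GamL : forall c a b,
  bigo (exterior r) (- 3) (fun x => Gam c a b x - gam_lead m c a b x).
Hypothesis PL : forall a b, bigo (exterior r) (- 4) (fun x => P a b x - ric_lead m a b x).


Lemma asymptotic_dichotomy : exists2 rho, r <= rho &
  (exists2 b, b != 0 & bigo (exterior rho) (- (1 / 2)) (fun x => f x - b)) \/
  (forall x, exterior rho x -> f x = 0).
Proof.
have [rho rrho [a [Ha fa]]] := first_order_limit r1 sf fE GamL PL.
have sub := subset_exterior rrho.
have rho1 : 1 <= rho by exact: le_trans rrho.
have rho0 : 0 < rho by exact: lt_le_trans rho1.
have sf' := smooth_on_open_sub sub sf.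
have fE' : linear_hessian rho f Gam P by move=> i j x /sub; exact: fE.
have GamL' c i j : bigo (exterior rho) (- 3) (fun x => Gam c i j x - gam_lead m c i j x).
  exact: bigo_sub sub (GamL c i j).
have PL' i j : bigo (exterior rho) (- 4) (fun x => P i j x - ric_lead m i j x).
  exact: bigo_sub sub (PL i j).
have a0 := limit_gradient_zero rho1 sf' fE' GamL' PL' Ha fa m0.
have ge1 x : exterior rho x -> 1 <= enorm (x : V).
  by move=> /ltW; exact: le_trans.
have GamO c i j : bigo (exterior rho) (- 2) (Gam c i j).
  by apply: (bigo_perturb ge1 _ (GamL' c i j)) (gam_lead_bigo m rho1 c i j (lexx _)); lra.
have PO i j : bigo (exterior rho) (- 3) (P i j).
  by apply: (bigo_perturb ge1 _ (PL' i j)) (ric_lead_bigo m rho1 i j (lexx _)); lra.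
have df1 c : bigo (exterior rho) (- (1 / 2)) (partials [:: c] f).
  by apply: bigo_ext (Ha c) => x _; rewrite a0 subr0.
have f1 : bigo (exterior rho) (1 / 2) f.
  by apply: bigo_ext fa => x _; rewrite big1 ?subr0// => k _; rewrite a0 mul0r.
have ddf i j : bigo (exterior rho) (- (3 / 2) - 1) (partials [:: i; j] f).
  apply: (hessian_bigo rho1 fE' GamO PO (lexx _)) => [c|].
    by rewrite (_ : _ + 2 = - (1 / 2))//; field.
  by rewrite (_ : _ + 3 = 1 / 2)//; field.
have [C1 C10 HC1] := bigo_uniform df1.
(* The limit of df is already known to be 0, so integration from infinity brings no constant. *)
have df2 c : bigo (exterior rho) (- (3 / 2)) (partials [:: c] f).
  have [C C0 HC] := bigo_uniform (fun k => ddf k c).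
  apply: bigo_intro => x rx.
  apply: (gradient_decay rho0 (smooth_has_gradient sf' [:: c] (lexx _)) _ HC
    (q := - (1 / 2)) (C1 := C1)) => //; try by lra.
  by move=> y ry; exact: HC1.
have [C C0 HC] := bigo_uniform df2.
have HC' k x : exterior rho x -> `|partials [:: k] f x| <= C * enorm x `^ (- (1 / 2) - 1).
  by move=> rx; rewrite (_ : - (1 / 2) - 1 = - (3 / 2)); [exact: HC|field].
have [b Hb] : exists L, bigo (exterior (2 * rho)) (- (1 / 2)) (fun x => f x - L).
  by apply: (gradient_limit rho0 (smooth_has_gradient sf' [::] (lexx _)) _ HC') => //; lra.
have rho2 : rho <= 2 * rho by rewrite ler_peMl ?(ltW rho0)// ler1n.
have sub2 := subset_exterior rho2.
have [b0|b0] := eqVneq b 0; last first.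
  by exists (2 * rho); [exact: le_trans rho2|left; exists b].
have fE2 : linear_hessian (2 * rho) f Gam P by move=> i j x /sub2; exact: fE'.
have f2 : bigo (exterior (2 * rho)) (- (1 / 2)) f.
  by apply: bigo_ext Hb => x _; rewrite b0 subr0.
have [s rs Hs] := vanishing_limit_zero (le_trans rho1 rho2)
  (smooth_on_open_sub sub2 sf') fE2 (fun c i j => bigo_sub sub2 (GamO c i j))
  (fun i j => bigo_sub sub2 (PO i j)) f2 (fun c => bigo_sub sub2 (df2 c)).
by exists s; [exact: le_trans (le_trans rrho rho2) rs|right].
Qed.

End Trichotomy.

(** * Curvature in coordinates *)

Section MatrixFunctions.
Context {R : realType} {V : normedModType R}.
Implicit Types (x v : V).

Lemma derivable_fprod (I : Type) (s : seq I) (F : I -> V -> R) x v :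
  (forall i, derivable (F i) x v) -> derivable (fun y => \prod_(i <- s) F i y) x v.
Proof.
move=> dF; elim: s => [|i s IH].
  by under eq_fun do rewrite big_nil; exact: derivable_cst.
under eq_fun do rewrite big_cons.
exact: (@derivableM R V (F i) (fun y => \prod_(j <- s) F j y) x v (dF i) IH).
Qed.

Lemma derivable_fsum (I : Type) (s : seq I) (F : I -> V -> R) x v :
  (forall i, derivable (F i) x v) -> derivable (fun y => \sum_(i <- s) F i y) x v.
Proof.
move=> dF; elim: s => [|i s IH].
  by under eq_fun do rewrite big_nil; exact: derivable_cst.
under eq_fun do rewrite big_cons.
exact: (@derivableD R V R (F i) (fun y => \sum_(j <- s) F j y) x v (dF i) IH).
Qed.

Lemma derivable_det n (A : V -> 'M[R]_n) x v :
  (forall i j, derivable (fun y => A y i j) x v) -> derivable (fun y => \det (A y)) x v.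
Proof.
move=> dA; apply: derivable_fsum => s; apply: derivableM; first exact: derivable_cst.
by apply: derivable_fprod => i; exact: dA.
Qed.

Lemma continuous_det n (A : V -> 'M[R]_n) x :
  (forall i j, {for x, continuous (fun y => A y i j)}) ->
  {for x, continuous (fun y => \det (A y))}.
Proof.
move=> cA; apply: continuous_fsum => s; apply: continuousM; first exact: cst_continuous.
by apply: continuous_fprod => i; exact: cA.
Qed.

Lemma invmx_entry n (A : 'M[R]_n) i j : A \in unitmx ->
  invmx A i j = (\det A)^-1 * ((-1) ^+ (j + i) * \det (row' j (col' i A))).
Proof. by move=> uA; rewrite /invmx uA !mxE. Qed.

Variables (n : nat) (U : set V) (A : V -> 'M[R]_n).
Hypothesis oU : open U.
Hypothesis uA : forall x, U x -> A x \in unitmx.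

Let invmx_near x (i j : 'I_n) : U x -> \forall y \near x,
  (\det (A y))^-1 * ((-1) ^+ (j + i) * \det (row' j (col' i (A y)))) = invmx (A y) i j.
Proof.
move=> Ux; apply: filterS (open_nbhs_nbhs (conj oU Ux)) => y Uy.
by rewrite invmx_entry// uA.
Qed.

Let minorE (i j : 'I_n) (y : V) k l : row' j (col' i (A y)) k l = A y (lift j k) (lift i l).
Proof. by rewrite !mxE. Qed.

Lemma derivable_invmx x v i j : U x -> (forall k l, derivable (fun y => A y k l) x v) ->
  derivable (fun y => invmx (A y) i j) x v.
Proof.
move=> Ux dA; apply: near_eq_derivable (invmx_near i j Ux) _.
apply: derivableM.
  apply: derivableV; last exact: derivable_det.
  by rewrite -unitfE -unitmxE uA.
apply: derivableM; first exact: derivable_cst.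
by apply: derivable_det => k l; under eq_fun do rewrite minorE; exact: dA.
Qed.

Lemma continuous_invmx x i j : U x -> (forall k l, {for x, continuous (fun y => A y k l)}) ->
  {for x, continuous (fun y => invmx (A y) i j)}.
Proof.
move=> Ux cA; have E := invmx_near i j Ux.
rewrite /prop_for /continuous_at -(nbhs_singleton E).
apply: cvg_trans (near_eq_cvg E) _.
apply: cvgM.
  apply: cvgV; first by rewrite -unitfE -unitmxE uA.
  exact: continuous_det.
apply: cvgM; first exact: cvg_cst.
apply: continuous_det => k l; have := cA (lift j k) (lift i l).
suff -> : (fun y => A y (lift j k) (lift i l)) = (fun y => row' j (col' i (A y)) k l) by [].
by apply/funext => y; rewrite minorE.
Qed.

(** Obtained by differentiating A^(-1) A = 1; that the entries of the inverse are derivable at all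
    comes from the cofactor formula. *)
Lemma is_derive_invmx x v i j (D : 'M[R]_n) : U x ->
  (forall k l, is_derive x v (fun y => A y k l) (D k l)) ->
  is_derive x v (fun y => invmx (A y) i j) (- (invmx (A x) *m D *m invmx (A x)) i j).
Proof.
move=> Ux dA.
have dH k l : derivable (fun y => invmx (A y) k l) x v.
  by apply: derivable_invmx => // p q; case: (dA p q).
pose H' : 'M[R]_n := \matrix_(k, l) 'D_v (fun y => invmx (A y) k l) x.
have E : H' *m A x + invmx (A x) *m D = 0.
  apply/matrixP => k l; rewrite !mxE -big_split/=.
  have L : is_derive x v (fun y => \sum_p invmx (A y) k p * A y p l)
     (\sum_p ('D_v (fun y => invmx (A y) k p) x * A x p l + invmx (A x) k p * D p l)).
    by apply: is_derive_fsum => p; apply: is_derive_fM; exact/derivableP.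
  have C : is_derive x v (fun y => \sum_p invmx (A y) k p * A y p l) 0.
    apply: near_eq_is_derive (is_derive_cst ((1%:M : 'M[R]_n) k l) x v).
    apply: filterS (open_nbhs_nbhs (conj oU Ux)) => y Uy.
    by rewrite -(mulVmx (uA Uy)) mxE.
  apply: etrans (is_derive_unique L C); apply: eq_bigr => p _.
  by rewrite mxE.
have H'E : H' = - (invmx (A x) *m D *m invmx (A x)).
  by rewrite -(addr0_eq E) mulNmx opprK mulmxK// uA.
move/matrixP/(_ i j): H'E; rewrite [LHS]mxE [RHS]mxE => <-.
exact/derivableP.
Qed.

End MatrixFunctions.

(** * Ricci curvature in terms of the derivatives of the metric up to order two *)

Section Curvature.
Context {R : realType}.
Notation V := 'rV[R]_3.
Implicit Types (a b c d e k l p q : 'I_3).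

Variables (U : set V) (g : V -> 'M[R]_3).
Hypothesis oU : open U.
Hypothesis sg : forall a b, smooth_on_open U (fun x => g x a b).
Hypothesis ug : forall x, U x -> g x \in unitmx.

Let H c d (x : V) : R := invmx (g x) c d.
Let D k a b (x : V) : R := partials [:: k] (fun y => g y a b) x.
Let DD l k a b (x : V) : R := partials [:: l; k] (fun y => g y a b) x.

(** An entry of -(g^(-1) (d_e g) g^(-1)), the derivative of the inverse metric. *)
Definition dinvmx e c d (x : V) : R :=
  - \sum_q (\sum_p H c p x * D e p q x) * H q d x.

(** Twice the Christoffel symbol of the first kind. *)
Definition christoffel1 a b d (x : V) : R := D a b d x + D b a d x - D d a b x.

Definition dchristoffel1 e a b d (x : V) : R := DD e a b d x + DD e b a d x - DD e d a b x.

Definition dchristoffel e c a b (x : V) : R := 2^-1 *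
  \sum_d (dinvmx e c d x * christoffel1 a b d x + H c d x * dchristoffel1 e a b d x).

Definition scalar_curvature (x : V) : R := \sum_a \sum_b H a b x * ricci g a b x.

(* The trace of the static equation gives [Delta f = - R f / 2]. *)
Definition static_potential_term a b (x : V) : R :=
  ricci g a b x - scalar_curvature x / 2 * g x a b.

Lemma christoffelE c a b x :
  christoffel g c a b x = 2^-1 * \sum_d H c d x * christoffel1 a b d x.
Proof. by []. Qed.

Lemma partial_christoffel e c a b x : U x ->
  partial e (christoffel g c a b) x = dchristoffel e c a b x.
Proof.
move=> Ux; apply: partial_is_derive.
have dH i j : is_derive x (axis e) (H i j) (dinvmx e i j x).
  have := @is_derive_invmx R V 3 U g oU ug x (axis e) i j (\matrix_(p, q) D e p q x) Ux.
  have -> : - (invmx (g x) *m (\matrix_(p, q) D e p q x) *m invmx (g x)) i j = dinvmx e i j x.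
    rewrite !mxE; congr (- _); apply: eq_bigr => q _; rewrite mxE; congr (_ * _).
    by apply: eq_bigr => p _; rewrite mxE.
  by apply=> p q; rewrite mxE; exact: (smooth_partial (sg p q) [::] e Ux).
have dD i j k : is_derive x (axis e) (D k i j) (DD e k i j x).
  exact: (smooth_partial (sg i j) [:: k] e Ux).
by apply: is_derive_fZ; apply: is_derive_fsum => d; apply: is_derive_fM.
Qed.

(** Removes the derivatives of quotients, so that power bounds apply to the Ricci tensor term by
    term. *)
Lemma ricciE a b x : U x -> ricci g a b x =
  \sum_c (dchristoffel c c a b x - dchristoffel b c a c x)
  + \sum_c \sum_d (christoffel g c c d x * christoffel g d a b x
       - christoffel g c b d x * christoffel g d a c x).
Proof.
move=> Ux; congr (_ + _); apply: eq_bigr => c _.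
by rewrite !partial_christoffel.
Qed.

Lemma static_linear_hessian (f : V -> R) x a b : U x -> (g x)^T = g x ->
  static_equation_at g f x -> partials [:: a; b] f x =
  \sum_c christoffel g c a b x * partials [:: c] f x + static_potential_term a b x * f x.
Proof.
move=> Ux gsym st; set L := laplacian g f x.
have trg : \sum_a \sum_b H a b x * g x a b = 3.
  transitivity (\tr (invmx (g x) *m (g x)^T)).
    apply: eq_bigr => i _; rewrite mxE; apply: eq_bigr => j _.
    by rewrite [in RHS]mxE.
  by rewrite gsym mulVmx ?ug// mxtrace1.
(* The trace of the equation in dimension three reads -3 L + L - f R = 0. *)
have LR : L = - f x * scalar_curvature x / 2.
  have : \sum_i \sum_j H i j x *
      (- L * g x i j + hessian g f i j x - f x * ricci g i j x) = 0.
    by apply: big1 => i _; apply: big1 => j _; rewrite st mulr0.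
  have -> : \sum_i \sum_j H i j x *
      (- L * g x i j + hessian g f i j x - f x * ricci g i j x) =
      - L * (\sum_i \sum_j H i j x * g x i j) + L - f x * scalar_curvature x.
    rewrite /L /laplacian /scalar_curvature !mulr_sumr -big_split/= -sumrB.
    apply: eq_bigr => i _; rewrite !mulr_sumr -big_split/= -sumrB.
    by apply: eq_bigr => j _; rewrite /H; ring.
  by rewrite trg => E; lra.
have := st a b; rewrite -/L LR /hessian /static_potential_term => E.
have -> : partials [:: a; b] f x = partials [:: a; b] f x
   - \sum_c christoffel g c a b x * partial c f x
   + \sum_c christoffel g c a b x * partials [:: c] f x by rewrite subrK.
move: E; rewrite [\sum_c christoffel g c a b x * partials _ _ _]/=.
by move: (\sum_c _) (partials _ _ _) => S F E; lra.
Qed.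

Section Bounded.
Variable A : set V.
Hypotheses (AU : A `<=` U) (A0 : forall x, A x -> 0 < enorm x).
Hypothesis gO : forall a b, bigo A 0 (fun x => g x a b).
Hypothesis HO : forall a b, bigo A 0 (H a b).
Hypothesis DO : forall k a b, bigo A 0 (D k a b).
Hypothesis DDO : forall l k a b, bigo A 0 (DD l k a b).

Let bigoM0 (F G : V -> R) : bigo A 0 F -> bigo A 0 G -> bigo A 0 (fun x => F x * G x).
Proof. by move=> HF HG; apply: bigoM HF HG => //; rewrite addr0. Qed.

(** Exponent 0 means plain boundedness; this version serves on compact annuli, where no asymptotics
    are available. *)
Lemma christoffel_bounded c a b : bigo A 0 (christoffel g c a b).
Proof.
apply: bigoZ; apply: bigo_fsum => d; apply: bigoM0; first exact: HO.
by apply: bigoB; [apply: bigoD|]; exact: DO.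
Qed.

Lemma ricci_bounded a b : bigo A 0 (ricci g a b).
Proof.
have dO e c i j : bigo A 0 (dchristoffel e c i j).
  apply: bigoZ; apply: bigo_fsum => d; apply: bigoD.
    apply: bigoM0.
      apply: bigoN; apply: bigo_fsum => q; apply: bigoM0 (HO _ _).
      by apply: bigo_fsum => p; exact: bigoM0.
    by apply: bigoB; [apply: bigoD|]; exact: DO.
  by apply: bigoM0; [exact: HO|apply: bigoB; [apply: bigoD|]; exact: DDO].
apply: bigo_ext (fun x Ax => esym (ricciE a b (AU Ax))) _.
apply: bigoD; apply: bigo_fsum => c; first exact: bigoB.
by apply: bigo_fsum => d; apply: bigoB; apply: bigoM0; exact: christoffel_bounded.
Qed.

Lemma static_potential_term_bounded a b : bigo A 0 (static_potential_term a b).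
Proof.
apply: bigoB; first exact: ricci_bounded.
apply: bigoM0 (gO a b); apply: bigoM0; last exact: bigo_cst.
apply: bigo_fsum => i; apply: bigo_fsum => j.
by apply: bigoM0; [exact: HO|exact: ricci_bounded].
Qed.

End Bounded.

End Curvature.

(** * Expansion of the curvature near infinity *)

Section CurvatureAsymptotics.
Context {R : realType}.
Notation V := 'rV[R]_3.
Implicit Types (a b c d e k l p q : 'I_3).

(** From M^(-1) = 1 - M^(-1) (M - 1), each entry of a row of the inverse is at most 1 + S / 6, where
    S is the sum of absolute values in that row. Summing gives S <= 3 + S / 2, that is S <= 6. *)
Lemma invmx_entry_bound (M : 'M[R]_3) : M \in unitmx ->
  (forall a b, `|M a b - (a == b)%:R| <= 6^-1) -> forall a b, `|invmx M a b| <= 6.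
Proof.
move=> uM B6 c d; pose S := \sum_d `|invmx M c d|.
have HE j : invmx M c j = (c == j)%:R - \sum_e invmx M c e * (M e j - (e == j)%:R).
  have /matrixP/(_ c j) := mulVmx uM; rewrite !mxE => <-.
  rewrite -sumrB -[LHS](sum_delta j (invmx M c)); apply: eq_bigr => e _.
  by ring.
have bH j : `|invmx M c j| <= 1 + 6^-1 * S.
  rewrite [in leLHS]HE; apply: le_trans (ler_normB _ _) _; apply: lerD.
    by case: (c == j); rewrite ?normr1 ?normr0.
  apply: le_trans (ler_norm_sum _ _ _) _; rewrite /S mulr_sumr; apply: ler_sum => e _.
  by rewrite normrM mulrC ler_wpM2r.
have S6 : S <= 6.
  have : S <= \sum_(j < 3) (1 + 6^-1 * S) by apply: ler_sum => j _; exact: bH.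
  by rewrite sumr_const card_ord -[leRHS]mulr_natl; lra.
apply: le_trans S6; rewrite /S (bigD1 d)//= lerDl.
by apply: sumr_ge0 => j _.
Qed.

Variables (r m : R) (g : V -> 'M[R]_3).
Hypothesis r1 : 1 <= r.
Hypothesis sg : forall a b, smooth_on_open (exterior r) (fun x => g x a b).
Hypothesis ug : forall x, exterior r x -> g x \in unitmx.

Notation H c d := (fun x : V => invmx (g x) c d).
Notation D k a b := (partials [:: k] (fun y => g y a b)).
Notation DD l k a b := (partials [:: l; k] (fun y => g y a b)).

(* The Hessian of [1/|x|]. *)
Definition newton_hessian l k (x : V) : R :=
  3 * x 0 l * x 0 k * (enorm x)^-1 ^+ 5 - (l == k)%:R * (enorm x)^-1 ^+ 3.

Hypothesis gL : forall a b, bigo (exterior r) (- 1) (fun x => g x a b - (a == b)%:R).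
Hypothesis DL : forall k a b, bigo (exterior r) (- 3)
  (fun x => D k a b x - - (2 * m) * (a == b)%:R * (x 0 k * (enorm x)^-1 ^+ 3)).
Hypothesis DDL : forall l k a b, bigo (exterior r) (- 4)
  (fun x => DD l k a b x - 2 * m * (a == b)%:R * newton_hessian l k x).

(** Beyond r + 6 C the entries of g - 1 are at most 1/6, so the inverse is bounded; the rate then
    follows from g^(-1) - 1 = -g^(-1) (g - 1). *)
Lemma inverse_metric_limit : exists2 rho, r <= rho &
  forall a b, bigo (exterior rho) (- 1) (fun x => H a b x - (a == b)%:R).
Proof.
have [C C0 HC] := bigo_uniform (fun i : 'I_3 * 'I_3 => gL i.1 i.2).
pose rho := r + 6 * C; exists rho; first by rewrite lerDl mulr_ge0.
have sub : exterior rho `<=` (exterior r : set V).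
  by move=> x; apply: le_lt_trans; rewrite lerDl mulr_ge0.
have pos x : exterior rho x -> 0 < enorm (x : V).
  by move=> /sub; apply: lt_trans; exact: lt_le_trans r1.
have Hb x c d : exterior rho x -> `|H c d x| <= 6.
  move=> rx; apply: invmx_entry_bound (ug (sub _ rx)) _ c d => a b.
  apply: le_trans (HC (a, b) _ (sub _ rx)) _.
  rewrite powR_inv1 ?enorm_ge0// ler_pdivrMr ?pos// mulrC ler_pdivlMr// mulrC.
  by apply: ltW; apply: le_lt_trans rx; rewrite lerDr (le_trans _ r1).
have HO c d : bigo (exterior rho) 0 (H c d).
  by apply: (@bigo_intro _ _ _ _ 6) => x rx; rewrite powRr0 mulr1 Hb.
move=> c d; have : bigo (exterior rho) (- 1)
    (fun x => - \sum_e H c e x * (g x e d - (e == d)%:R)).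
  apply: bigoN; apply: bigo_fsum => e.
  by apply: bigoM pos _ (HO c e) (bigo_sub sub (gL e d)); rewrite add0r.
apply: bigo_ext => x rx.
have /matrixP/(_ c d) := mulVmx (ug (sub _ rx)); rewrite !mxE => <-.
rewrite -sumrN -[invmx (g x) c d](sum_delta d (invmx (g x) c)) -sumrB.
by apply: eq_bigr => e _; ring.
Qed.

(** Contraction of the linearised derivative terms of the Ricci tensor; the factor 3 is the
    dimension, from the trace of the identity. *)
Let sum_ricci_lead (F G X Y Z W : 'I_3 -> R) (n d w : R) :
  \sum_c (F c - n * (X c + Y c - d * Z c) - (G c - n * ((c == c)%:R * w + W c - W c))) =
  \sum_c (F c - G c) - n * (\sum_c X c + \sum_c Y c - d * \sum_c Z c) + 3 * n * w.
Proof. by rewrite !sum3E !eqxx /=; ring. Qed.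

Let sub3 (x y z x' y' z' : R) : x - x' + (y - y') - (z - z') = x + y - z - (x' + y' - z').
Proof. ring. Qed.

(** Products of Christoffel symbols, and the deviation of the inverse metric from the identity,
    enter the Ricci tensor only at order |x|^(-4). The linear part contracts to -m times the Hessian
    of 1/|x|, because 1/|x| is harmonic. This tensor is trace-free, so the scalar curvature is
    O(|x|^(-4)) and does not affect the leading part. *)
Lemma curvature_asymptotics : exists2 rho, r <= rho &
  (forall c a b, bigo (exterior rho) (- 3)
    (fun x => christoffel g c a b x - gam_lead m c a b x)) /\
  (forall a b, bigo (exterior rho) (- 4)
    (fun x => static_potential_term g a b x - ric_lead m a b x)).
Proof.
have [rho rrho HL] := inverse_metric_limit; exists rho => //.
set A := exterior rho in HL *.
have sub : A `<=` (exterior r : set V) by move=> x; exact: le_lt_trans.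
have rho1 : 1 <= rho by exact: le_trans rrho.
have ge1 x : A x -> 1 <= enorm (x : V) by exact: exterior_ge1.
have pos x : A x -> 0 < enorm (x : V) by move=> /ge1; exact: lt_le_trans.
have gLA a b := bigo_sub sub (gL a b).
have DLA k a b := bigo_sub sub (DL k a b).
have DDLA l k a b := bigo_sub sub (DDL l k a b).
have invn n : bigo A (- n%:R) (fun x => (enorm x)^-1 ^+ n) by exact: bigo_invn.
have delta a b : bigo A 0 (fun=> (a == b)%:R : R) by exact: bigo_cst.
have HO c d : bigo A 0 (H c d).
  by apply: (bigo_perturb ge1 _ (HL c d)) ((delta c d)); lra.
have gO c d : bigo A 0 (fun x => g x c d).
  by apply: (bigo_perturb ge1 _ (gLA c d)) ((delta c d)); lra.
have newtonO l k : bigo A (- 3) (newton_hessian l k).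
  apply: bigoB; last by apply: bigoZ; exact: invn.
  apply: (bigoM pos _ _ (invn 5%N) (p := 2)); first by ring.
  apply: (bigoM pos _ _ (bigo_coord _ k) (p := 1)); first by ring.
  by apply: bigoZ; exact: bigo_coord.
have DO k a b : bigo A (- 2) (D k a b).
  have lead : bigo A (- 2) (fun x : V => - (2 * m) * (a == b)%:R * (x 0 k * (enorm x)^-1 ^+ 3)).
    by apply: bigoZ; apply: (bigoM pos _ (bigo_coord _ k) (invn 3%N)); ring.
  by apply: (bigo_perturb ge1 _ (DLA k a b)) (lead); lra.
have DDO l k a b : bigo A (- 3) (DD l k a b).
  have lead : bigo A (- 3) (fun x : V => 2 * m * (a == b)%:R * newton_hessian l k x).
    by apply: bigoZ; exact: newtonO.
  by apply: (bigo_perturb ge1 _ (DDLA l k a b)) (lead); lra.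
have c1O a b d : bigo A (- 2) (christoffel1 g a b d).
  by apply: bigoB; [apply: bigoD|]; exact: DO.
have dc1O e a b d : bigo A (- 3) (dchristoffel1 g e a b d).
  by apply: bigoB; [apply: bigoD|]; exact: DDO.
have gamL c a b : bigo A (- 3) (fun x => christoffel g c a b x - gam_lead m c a b x).
  pose S1 d (x : V) := - (2 * m) * (b == d)%:R * (x 0 a * (enorm x)^-1 ^+ 3)
    + - (2 * m) * (a == d)%:R * (x 0 b * (enorm x)^-1 ^+ 3)
    - - (2 * m) * (a == b)%:R * (x 0 d * (enorm x)^-1 ^+ 3).
  have T1 : bigo A (- 3) (fun x => 2^-1 *
      \sum_d ((H c d x - (c == d)%:R) * christoffel1 g a b d x)).
    apply: bigoZ; apply: bigo_fsum => d; apply: (bigoM pos _ (HL c d) (c1O a b d)); ring.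
  have T2 : bigo A (- 3) (fun x => 2^-1 * (christoffel1 g a b c x - S1 c x)).
    apply: bigoZ; apply: bigo_ext (bigoB (bigoD (DLA a b c) (DLA b a c)) (DLA c a b)).
    by move=> x _; exact: sub3.
  apply: bigo_ext (bigoD T1 T2) => x Ax.
  rewrite christoffelE.
  rewrite -(sum_delta c (fun d => christoffel1 g a b d x)) mulrBr addrA -mulrDr -big_split/=.
  congr (_ - _).
    by congr (_ * _); apply: eq_bigr => d _; rewrite [d == c]eq_sym; ring.
  by rewrite /S1 /gam_lead; move: (enorm x)^-1 => u; field.
have gamO c a b : bigo A (- 2) (christoffel g c a b).
  by apply: (bigo_perturb ge1 _ (gamL c a b)) ((gam_lead_bigo m r1 c a b rrho)); lra.
have dgamL e c a b : bigo A (- 4) (fun x => dchristoffel g e c a b x -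
    m * ((b == c)%:R * newton_hessian e a x + (a == c)%:R * newton_hessian e b x
       - (a == b)%:R * newton_hessian e c x)).
  pose S1 d (x : V) := 2 * m * (b == d)%:R * newton_hessian e a x
    + 2 * m * (a == d)%:R * newton_hessian e b x
    - 2 * m * (a == b)%:R * newton_hessian e d x.
  have T0 : bigo A (- 4) (fun x => 2^-1 * \sum_d (dinvmx g e c d x * christoffel1 g a b d x)).
    apply: bigoZ; apply: bigo_fsum => d; apply: (bigoM pos _ _ (c1O a b d) (p := - 2)).
      by ring.
    apply: bigoN; apply: bigo_fsum => q; apply: (bigoM pos _ _ (HO q d) (p := - 2)).
      by ring.
    by apply: bigo_fsum => p; apply: (bigoM pos _ (HO c p) (DO e p q)); ring.
  have T1 : bigo A (- 4) (fun x => 2^-1 *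
      \sum_d ((H c d x - (c == d)%:R) * dchristoffel1 g e a b d x)).
    apply: bigoZ; apply: bigo_fsum => d; apply: (bigoM pos _ (HL c d) (dc1O e a b d)); ring.
  have T2 : bigo A (- 4) (fun x => 2^-1 * (dchristoffel1 g e a b c x - S1 c x)).
    apply: bigoZ; apply: bigo_ext (bigoB (bigoD (DDLA e a b c) (DDLA e b a c)) (DDLA e c a b)).
    by move=> x _; exact: sub3.
  apply: bigo_ext (bigoD T0 (bigoD T1 T2)) => x Ax.
  rewrite /dchristoffel.
  rewrite -(sum_delta c (fun d => dchristoffel1 g e a b d x)) mulrBr !addrA -!mulrDr -!big_split/=.
  congr (_ - _).
    by congr (_ * _); apply: eq_bigr => d _; rewrite [d == c]eq_sym; ring.
  by rewrite /S1; move: (newton_hessian e) => W; field.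
have ricL a b : bigo A (- 4) (fun x => ricci g a b x - ric_lead m a b x).
  have Q : bigo A (- 4) (fun x => \sum_c \sum_d
      (christoffel g c c d x * christoffel g d a b x
       - christoffel g c b d x * christoffel g d a c x)).
    apply: bigo_fsum => c; apply: bigo_fsum => d.
    by apply: bigoB; apply: (bigoM pos _ (gamO _ _ _) (gamO _ _ _)); ring.
  have L : bigo A (- 4) (fun x => \sum_c
      ((dchristoffel g c c a b x -
        m * ((b == c)%:R * newton_hessian c a x + (a == c)%:R * newton_hessian c b x
           - (a == b)%:R * newton_hessian c c x)) -
       (dchristoffel g b c a c x -
        m * ((c == c)%:R * newton_hessian b a x + (a == c)%:R * newton_hessian b c x
           - (a == c)%:R * newton_hessian b c x)))).
    by apply: bigo_fsum => c; exact: bigoB.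
  apply: bigo_ext (bigoD L Q) => x Ax.
  rewrite (@ricciE R _ g (@exterior_open R r) sg ug a b x (sub _ Ax)).
  rewrite [RHS]addrAC; congr (_ + _).
  have nsym i j : newton_hessian i j x = newton_hessian j i x.
    by rewrite /newton_hessian [i == j]eq_sym; ring.
  (* The function 1/|x| is harmonic. *)
  have tr0 : \sum_c newton_hessian c c x = 0.
    have x0 := pos _ Ax.
    transitivity (3 * (enorm x)^-1 ^+ 5 * (\sum_c x 0 c ^+ 2) - 3 * (enorm x)^-1 ^+ 3).
      by rewrite /newton_hessian !sum3E !eqxx /=; move: (enorm x)^-1 => u; ring.
    by rewrite -sqr_enorm; field; rewrite gt_eqF.
  have : \sum_c (b == c)%:R * newton_hessian c a x = newton_hessian b a x.
    rewrite -[RHS](sum_delta b (fun c => newton_hessian c a x)).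
    by apply: eq_bigr => c _; rewrite eq_sym.
  have : \sum_c (a == c)%:R * newton_hessian c b x = newton_hessian a b x.
    rewrite -[RHS](sum_delta a (fun c => newton_hessian c b x)).
    by apply: eq_bigr => c _; rewrite eq_sym.
  move=> E1 E2; rewrite sum_ricci_lead E1 E2 tr0 [newton_hessian b a x]nsym.
  by rewrite /ric_lead /newton_hessian; move: (enorm x)^-1 => u; ring.
have ricO a b : bigo A (- 3) (ricci g a b).
  by apply: (bigo_perturb ge1 _ (ricL a b)) ((ric_lead_bigo m r1 a b rrho)); lra.
have scalO : bigo A (- 4) (scalar_curvature g).
  have T1 : bigo A (- 4) (fun x => \sum_a \sum_b (H a b x - (a == b)%:R) * ricci g a b x).
    apply: bigo_fsum => a; apply: bigo_fsum => b.
    by apply: (bigoM pos _ (HL a b) (ricO a b)); ring.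
  have T2 : bigo A (- 4) (fun x => \sum_a (ricci g a a x - ric_lead m a a x)).
    by apply: bigo_fsum => a.
  apply: bigo_ext (bigoD T1 T2) => x Ax.
  have x0 := pos _ Ax.
  have tr0 : \sum_a ric_lead m a a x = 0.
    transitivity (m * (3 * (enorm x)^-1 ^+ 3 - 3 * (enorm x)^-1 ^+ 5 * (\sum_c x 0 c ^+ 2))).
      by rewrite /ric_lead !sum3E !eqxx /=; move: (enorm x)^-1 => u; ring.
    by rewrite -sqr_enorm; field; rewrite gt_eqF.
  rewrite sumrB tr0 subr0 -big_split/=; apply: eq_bigr => a _.
  rewrite -(sum_delta a (fun b => ricci g a b x)) -big_split/=; apply: eq_bigr => b _.
  by rewrite [b == a]eq_sym; ring.
split=> // a b.
have T : bigo A (- 4) (fun x => scalar_curvature g x / 2 * g x a b).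
  apply: (bigoM pos _ _ (gO a b) (p := - 4)); first by ring.
  by apply: bigo_ext (bigoZ 2^-1 scalO) => x _; rewrite mulrC.
apply: bigo_ext (bigoB (ricL a b) T) => x Ax.
by rewrite /static_potential_term; ring.
Qed.

End CurvatureAsymptotics.

(** * The Schwarzschild metric *)

Section SchwarzschildFactor.
Context {R : realType}.
Notation V := 'rV[R]_3.
Implicit Types (k l a b : 'I_3) (x v : V).

Lemma is_derive_fcst (c : R) x v : is_derive x v (fun=> c) 0.
Proof. exact: is_derive_cst. Qed.

Lemma is_derive_inv_enorm x k : 0 < enorm x ->
  is_derive x (axis k) (fun y => (enorm y)^-1) (- (x 0 k * (enorm x)^-1 ^+ 3)).
Proof.
move=> x0.
have S : is_derive x (axis k) (fun y : V => \sum_a y 0 a ^+ 2) (2 * x 0 k).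
  have -> : (fun y : V => \sum_a y 0 a ^+ 2) = (fun y => \sum_a y 0 a * y 0 a).
    by apply/funext => y; apply: eq_bigr => a _; rewrite expr2.
  have -> : 2 * x 0 k = \sum_a ((axis k : V) 0 a * x 0 a + x 0 a * (axis k : V) 0 a).
    rewrite -(sum_delta k (fun a => 2 * x 0 a)); apply: eq_bigr => a _.
    by rewrite axisE; ring.
  apply: is_derive_fsum => a; apply: is_derive_fM; exact: is_derive_coord.
have Sx : 0 < \sum_a x 0 a ^+ 2 by rewrite -sqr_enorm exprn_gt0.
have N := is_derive_comp1 S (is_derive1_sqrt Sx).
have := is_derive_finv N (lt0r_neq0 x0).
have -> : - (enorm x) ^- 2 * ((2 * Num.sqrt (\sum_a x 0 a ^+ 2))^-1 * (2 * x 0 k)) =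
  - (x 0 k * (enorm x)^-1 ^+ 3); last by [].
by rewrite -/(enorm x); field; rewrite gt_eqF.
Qed.

Variable m : R.

Definition schwarzschild x : R := (1 + m / (2 * enorm x)) ^+ 4.

Let v x := m / 2 * (enorm x)^-1.

Definition dschwarzschild k x : R := - (2 * m) * (1 + v x) ^+ 3 * (x 0 k * (enorm x)^-1 ^+ 3).

Definition ddschwarzschild l k x : R :=
  2 * m * ((1 + v x) ^+ 3 * newton_hessian l k x +
    3 * m / 2 * (1 + v x) ^+ 2 * (x 0 l * x 0 k * (enorm x)^-1 ^+ 6)).

Let is_derive_1v x l : 0 < enorm x ->
  is_derive x (axis l) (fun y => 1 + v y) (- (m / 2) * (x 0 l * (enorm x)^-1 ^+ 3)).
Proof.
move=> x0; have := is_derive_fD (is_derive_fcst 1 x (axis l))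
  (is_derive_fZ (m / 2) (is_derive_inv_enorm l x0)).
by rewrite add0r mulrN mulNr.
Qed.

Lemma is_derive_pow (F : V -> R) x w (d : R) n : is_derive x w F d ->
  is_derive x w (fun y => F y ^+ n) (n%:R * F x ^+ n.-1 * d).
Proof.
move=> Fd; have -> : (fun y => F y ^+ n) = F ^+ n by apply/funext => y; rewrite exprfctE.
exact: is_deriveX.
Qed.

Lemma is_derive_schwarzschild x k : 0 < enorm x ->
  is_derive x (axis k) schwarzschild (dschwarzschild k x).
Proof.
move=> x0; have -> : schwarzschild = (fun y => (1 + v y) ^+ 4).
  by apply/funext => y; rewrite /schwarzschild /v invfM mulrA.
have := is_derive_pow 4 (is_derive_1v k x0).
by congr is_derive; rewrite /dschwarzschild/=; move: (v x) (enorm x)^-1 => V u; field.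
Qed.

Lemma is_derive_dschwarzschild x l k : 0 < enorm x ->
  is_derive x (axis l) (dschwarzschild k) (ddschwarzschild l k x).
Proof.
move=> x0.
have := is_derive_fM (is_derive_fZ (- (2 * m)) (is_derive_pow 3 (is_derive_1v l x0)))
  (is_derive_fM (is_derive_coord x (axis l) k) (is_derive_pow 3 (is_derive_inv_enorm l x0))).
congr is_derive; rewrite /ddschwarzschild /newton_hessian/= axisE [k == l]eq_sym.
by move: (v x) (enorm x)^-1 (l == k)%:R => V u d; field.
Qed.

Variable (A : set V).
Hypothesis A1 : forall x, A x -> 1 <= enorm x.
Let A0 x : A x -> 0 < enorm x. Proof. by move=> /A1; exact: lt_le_trans. Qed.

Let vO : bigo A (- 1) v.
Proof. by apply: bigoZ; exact: (@bigo_invn R A 1). Qed.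
Let vO0 : bigo A 0 v.
Proof. by apply: (bigo_weak A1 _ vO); lra. Qed.
Let bM0 (F G : V -> R) : bigo A 0 F -> bigo A 0 G -> bigo A 0 (fun x => F x * G x).
Proof. by move=> FO GO; apply: (bigoM A0 _ FO GO); rewrite addr0. Qed.
Let v2O : bigo A 0 (fun x => v x * v x). Proof. exact: bM0. Qed.
Let cO c : bigo A 0 (fun=> c : R). Proof. exact: bigo_cst. Qed.

Lemma schwarzschild_limit : bigo A (- 1) (fun x => schwarzschild x - 1).
Proof.
have P : bigo A 0 (fun x => 4 + 6 * v x + 4 * (v x * v x) + v x * (v x * v x)).
  apply: bigoD; last exact: bM0.
  apply: bigoD; last exact: bigoZ.
  by apply: bigoD; [exact: cO|exact: bigoZ].
apply: bigo_ext (bigoM A0 (esym (addr0 (- 1))) vO P) => x _.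
have -> : schwarzschild x = (1 + v x) ^+ 4 by rewrite /schwarzschild /v invfM mulrA.
by move: (v x) => V; ring.
Qed.

Let cube : bigo A (- 1) (fun x => (1 + v x) ^+ 3 - 1).
Proof.
have P : bigo A 0 (fun x => 3 + 3 * v x + v x * v x).
  apply: bigoD; last exact: v2O.
  by apply: bigoD; [exact: cO|exact: bigoZ].
apply: bigo_ext (bigoM A0 (esym (addr0 (- 1))) vO P) => x _.
by move: (v x) => V; ring.
Qed.

Lemma dschwarzschild_limit k : bigo A (- 3)
  (fun x => dschwarzschild k x - - (2 * m) * (x 0 k * (enorm x)^-1 ^+ 3)).
Proof.
have L : bigo A (- 2) (fun x => - (2 * m) * (x 0 k * (enorm x)^-1 ^+ 3)).
  by apply: bigoZ; apply: (bigoM A0 _ (bigo_coord _ k) (bigo_invn A 3)); ring.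
have e : - 3 = - 1 + - 2 :> R by ring.
apply: bigo_ext (bigoM A0 e cube L) => x _.
by rewrite /dschwarzschild; move: (v x) (enorm x)^-1 => V u; ring.
Qed.

Lemma ddschwarzschild_limit l k : bigo A (- 4)
  (fun x => ddschwarzschild l k x - 2 * m * newton_hessian l k x).
Proof.
have N : bigo A (- 3) (newton_hessian l k).
  apply: bigoB; last by apply: bigoZ; exact: (bigo_invn A 3).
  apply: (bigoM A0 _ _ (bigo_invn A 5) (p := 2)); first by ring.
  apply: (bigoM A0 _ _ (bigo_coord _ k) (p := 1)); first by ring.
  by apply: bigoZ; exact: bigo_coord.
have X : bigo A (- 4) (fun x => x 0 l * x 0 k * (enorm x)^-1 ^+ 6).
  apply: (bigoM A0 _ _ (bigo_invn A 6) (p := 2)); first by ring.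
  by apply: (bigoM A0 _ (bigo_coord _ l) (bigo_coord _ k)); ring.
have Q : bigo A 0 (fun x => 3 * m / 2 * ((1 + v x) * (1 + v x))).
  by apply: bigoZ; apply: bM0; apply: bigoD => //; exact: cO.
have e : - 4 = - 1 + - 3 :> R by ring.
have e' : - 4 = 0 + - 4 :> R by ring.
apply: bigo_ext (bigoZ (2 * m) (bigoD (bigoM A0 e cube N) (bigoM A0 e' Q X))) => x _.
by rewrite /ddschwarzschild; move: (v x) (enorm x)^-1 (newton_hessian l k x) => V u W; ring.
Qed.

End SchwarzschildFactor.

(** * Expansion of an asymptotically Schwarzschild metric and its derivatives *)

Section SchwarzschildMetric.
Context {R : realType}.
Notation V := 'rV[R]_3.
Implicit Types (k l a b : 'I_3).
Variables (r m : R) (g : V -> 'M[R]_3).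
Hypothesis r0 : 0 < r.
Hypothesis sg : forall a b, smooth_on_open (exterior r) (fun x => g x a b).
Hypothesis gS : forall a b, bigO_deriv 2 2 r
  (fun x => g x a b - (1 + m / (2 * enorm x)) ^+ 4 * (a == b)%:R).

(** The shift by 1 ensures |x| >= 1 whatever the radius [r] of the chart. *)
Let A : set V := exterior (r + 1).
Let sub : A `<=` (exterior r : set V).
Proof. by move=> x; apply: le_lt_trans; rewrite lerDl. Qed.
Let A1 x : A x -> 1 <= enorm x.
Proof. by move=> /ltW; apply: le_trans; rewrite lerDr ltW. Qed.
Let A0 x : exterior r x -> 0 < enorm x. Proof. exact: lt_trans. Qed.

Let p a b x := g x a b - schwarzschild m x * (a == b)%:R.

Let pO a b (s : seq 'I_3) (q : R) : (size s <= 2)%N -> - 2 - (size s)%:R = q ->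
  bigo A q (partials s (p a b)).
Proof.
move=> s2 <-; have [C HC] := gS a b; apply: (@bigo_intro _ _ _ _ C) => x Ax.
exact: HC s x s2 (sub Ax).
Qed.

Let partial_p a b k x : exterior r x -> partials [:: k] (p a b) x =
  partials [:: k] (fun y => g y a b) x - dschwarzschild m k x * (a == b)%:R.
Proof.
move=> rx; apply: partial_is_derive.
have := is_derive_fB (smooth_partial (sg a b) [::] k rx)
  (is_derive_fM (is_derive_schwarzschild m k (A0 rx)) (is_derive_fcst (a == b)%:R x (axis k))).
by rewrite mulr0 addr0.
Qed.

Let partial2_p a b l k x : exterior r x -> partials [:: l; k] (p a b) x =
  partials [:: l; k] (fun y => g y a b) x - ddschwarzschild m l k x * (a == b)%:R.
Proof.
move=> rx.
have -> : partials [:: l; k] (p a b) x = partials [:: l] (fun y =>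
    partials [:: k] (fun y => g y a b) y - dschwarzschild m k y * (a == b)%:R) x.
  apply: (@partials_local R (exterior r) _ _ [:: l] (@exterior_open R r)) rx => y.
  exact: partial_p.
apply: partial_is_derive.
have := is_derive_fB (smooth_partial (sg a b) [:: k] l rx)
  (is_derive_fM (is_derive_dschwarzschild m l k (A0 rx)) (is_derive_fcst (a == b)%:R x (axis l))).
by rewrite mulr0 addr0.
Qed.

(** Order -1 is enough for the components themselves: in the curvature expansion they always
    multiply derivatives of the metric. *)
Lemma metric_limit a b : bigo A (- 1) (fun x => g x a b - (a == b)%:R).
Proof.
have P : bigo A (- 2) (partials [::] (p a b)) by apply: pO => //; rewrite subr0.
have P1 := bigo_weak A1 (_ : - 2 <= - 1) P.
apply: bigo_ext (bigoD (P1 _) (bigoZ (a == b)%:R (schwarzschild_limit m A1))) => [x _|].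
  by rewrite /= /p; move: (schwarzschild m x) (a == b)%:R => S d; ring.
by lra.
Qed.

Lemma dmetric_limit k a b : bigo A (- 3) (fun x => partials [:: k] (fun y => g y a b) x
   - - (2 * m) * (a == b)%:R * (x 0 k * (enorm x)^-1 ^+ 3)).
Proof.
have P : bigo A (- 3) (partials [:: k] (p a b)) by apply: pO => //=; ring.
apply: bigo_ext (bigoD P (bigoZ (a == b)%:R (dschwarzschild_limit m A1 k))) => x Ax.
rewrite partial_p; last exact: sub.
by move: (dschwarzschild m k x) (a == b)%:R (enorm x)^-1 => S d u; ring.
Qed.

Lemma ddmetric_limit l k a b : bigo A (- 4) (fun x => partials [:: l; k] (fun y => g y a b) x
   - 2 * m * (a == b)%:R * newton_hessian l k x).
Proof.
have P : bigo A (- 4) (partials [:: l; k] (p a b)) by apply: pO => //=; ring.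
apply: bigo_ext (bigoD P (bigoZ (a == b)%:R (ddschwarzschild_limit m A1 l k))) => x Ax.
rewrite partial2_p; last exact: sub.
by move: (ddschwarzschild m l k x) (a == b)%:R (newton_hessian l k x) => S d W; ring.
Qed.

End SchwarzschildMetric.

(** * Unique continuation and the theorem *)

Section UniqueContinuation.
Context {R : realType}.
Notation V := 'rV[R]_3.
Variables (r : R) (g : V -> 'M[R]_3) (f : V -> R).
Hypothesis r0 : 0 < r.
Hypothesis sg : forall a b, smooth_on_open (exterior r) (fun x => g x a b).
Hypothesis ug : forall x, exterior r x -> g x \in unitmx.
Hypothesis gsym : forall x, exterior r x -> (g x)^T = g x.
Hypothesis sf : smooth_on_open (exterior r) f.
Hypothesis st : forall x, exterior r x -> static_equation_at g f x.

(** Gronwall is run inwards, so E' is bounded from below by -K E for E = f^2 + |df|^2. With q^2 <= 3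
    S, the terms in [G] contribute at most 9 G q^2 + 3 G h^2 and the remaining one at most q^2 +
    h^2, whence K = 3 (1 + 9 G). *)
Let energy_rate (h d0 q G S : R) (y dd : 'I_3 -> R) : 0 <= G ->
  S = \sum_j y j * y j -> q = \sum_j `|y j| -> `|d0| <= q ->
  (forall j, `|dd j| <= 3 * (G * q + G * `|h|)) ->
  0 <= d0 * h + h * d0 + \sum_j (dd j * y j + y j * dd j) +
    3 * (1 + 9 * G) * (h * h + S).
Proof.
move=> G0 SE qE d0q ddq.
have q0 : 0 <= q by rewrite qE sumr_ge0.
have qS : q * q <= 3 * S.
  rewrite qE SE !sum3E.
  rewrite -[y 0 * _]expr2 -[y 1 * _]expr2 -[y 2%:R * _]expr2.
  rewrite -(real_normK (num_real (y 0))) -(real_normK (num_real (y 1))).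
  rewrite -(real_normK (num_real (y 2%:R))).
  move: `|y 0| `|y 1| `|y 2%:R| => u v w.
  have := sqr_ge0 (u - v); have := sqr_ge0 (u - w); have := sqr_ge0 (v - w).
  nra.
have B : `|\sum_j (dd j * y j + y j * dd j)| <= 6 * q * (G * q + G * `|h|).
  apply: le_trans (ler_norm_sum _ _ _) _; rewrite {1}qE mulr_sumr mulr_suml.
  apply: ler_sum => j _; have -> : dd j * y j + y j * dd j = 2 * (y j * dd j) by ring.
  rewrite !normrM (ger0_norm (ler0n _ _)).
  have := ler_wpM2l (normr_ge0 (y j)) (ddq j).
  move: (G * q + _) `|y j| `|dd j| => X Y Z; lra.
have B0 : `|d0 * h + h * d0| <= 2 * (q * `|h|).
  rewrite (_ : _ + _ = 2 * (d0 * h)); last by ring.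
  rewrite !normrM (ger0_norm (ler0n _ _)) ler_wpM2l// ler_wpM2r//.
have hh : h * h = `|h| * `|h| by rewrite -!expr2 real_normK ?num_real.
move: B B0; rewrite !ler_norml hh => /andP[B _] /andP[B0 _].
have H0 := normr_ge0 h; move: `|h| H0 B B0 => H H0 B B0.
have P0 : 0 <= q * H by rewrite mulr_ge0.
have P1 : 2 * (q * H) <= q * q + H * H by have := sqr_ge0 (q - H); nra.
have P2 := ler_wpM2l G0 P1; have P3 := ler_wpM2l G0 qS.
have P4 : 0 <= H * H by rewrite mulr_ge0.
have P5 := mulr_ge0 G0 P4.
move: (\sum_j _) (d0 * h + _) B B0 => X Y B B0; nra.
Qed.

(** The coefficients need not be bounded near the removed ball, but they are on the compact annulus
    between |x| and [T], and a constant depending on [x] is harmless. The product of E and exp(K u)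
    is nondecreasing along the ray and vanishes at [T], hence E is at most 0 at [x]. *)
Lemma static_potential_unique_continuation t : r <= t ->
  (forall x, exterior t x -> f x = 0) -> forall x, exterior r x -> f x = 0.
Proof.
move=> rt ft x rx; pose s := enorm x.
have s0 : 0 < s by exact: lt_trans rx.
have [ts|st'] := ltP t s; first exact: ft.
(* Strictly beyond [t] the function vanishes on a neighbourhood, so its gradient vanishes at the
   outer end of the ray as well. *)
pose T := t + 1; pose A : set V := annulus s T.
have sub : A `<=` (exterior r : set V) by move=> y /andP[sy _]; exact: lt_le_trans sy.
have A0 y : A y -> 0 < enorm (y : V) by move=> /andP[sy _]; exact: lt_le_trans sy.
have bd (F : V -> R) : (forall y, A y -> {for y, continuous F}) -> bigo A 0 F.
  by move=> /annulus_bounded[C C0 HC]; exists C => // y Ay; rewrite powRr0 mulr1 HC.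
have cg a b y : A y -> {for y, continuous (fun z => g z a b)}.
  by move=> /sub ry; exact: (smooth_continuous (sg a b) (s := [::])).
have gO a b : bigo A 0 (fun y => g y a b) by apply: bd => y; exact: cg.
have HO a b : bigo A 0 (fun y => invmx (g y) a b).
  apply: bd => y Ay; apply: (continuous_invmx (@exterior_open R r) ug (sub _ Ay)) => k l.
  exact: cg.
have DO k a b : bigo A 0 (partials [:: k] (fun y => g y a b)).
  by apply: bd => y /sub ry; exact: (smooth_continuous (sg a b)).
have DDO l k a b : bigo A 0 (partials [:: l; k] (fun y => g y a b)).
  by apply: bd => y /sub ry; exact: (smooth_continuous (sg a b)).
have [G1 G10 HG] := bigo_uniform (fun i : 'I_3 * 'I_3 * 'I_3 =>
  christoffel_bounded A0 HO DO i.1.1 i.1.2 i.2).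
have [G2 G20 HP] := bigo_uniform (fun i : 'I_3 * 'I_3 =>
  static_potential_term_bounded (@exterior_open R r) sg ug sub A0 gO HO DO DDO i.1 i.2).
pose G := G1 + G2; have G0 : 0 <= G by exact: addr_ge0.
have HG' c a b y : A y -> `|christoffel g c a b y| <= G.
  move=> Ay; apply: le_trans (HG (c, a, b) y Ay) _.
  by rewrite powRr0 mulr1 lerDl.
have HP' a b y : A y -> `|static_potential_term g a b y| <= G.
  move=> Ay; apply: le_trans (HP (a, b) y Ay) _.
  by rewrite powRr0 mulr1 lerDr.
clearbody G.
have th1 := enorm_ray_dir s0; set th := ray_dir x in th1.
have inA u : s <= u <= T -> A (u *: th).
  move=> /andP[su uT]; rewrite /A /annulus/= enormZ th1 mulr1 ger0_norm ?su//.
  by apply: le_trans su; exact: ltW.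
have lineD w u : s <= u <= T -> is_derive u 1 (fun v => partials w f (v *: th))
    (\sum_k th 0 k * partials (k :: w) f (u *: th)).
  move=> /inA/sub eu.
  have := @smooth_line R (exterior r) f (@exterior_open R r) sf w (0 : V) th u.
  by under eq_fun do rewrite add0r; rewrite add0r; exact.
pose y j u := partials [:: j] f (u *: th).
pose dd j u := \sum_k th 0 k * partials [:: k; j] f (u *: th).
pose h u := f (u *: th).
pose d0 u := \sum_k th 0 k * partials [:: k] f (u *: th).
pose E u := h u * h u + \sum_j y j u * y j u.
pose dE u := d0 u * h u + h u * d0 u + \sum_j (dd j u * y j u + y j u * dd j u).
have dEE u : s <= u <= T -> is_derive u 1 E (dE u).
  move=> su; apply: is_derive_fD.
    by apply: is_derive_fM; exact: (lineD [::]).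
  by apply: is_derive_fsum => j; apply: is_derive_fM; exact: (lineD [:: j]).
pose K := 3 * (1 + 9 * G).
have dexp (u : R) : is_derive u 1 (fun v => expR (K * v)) (expR (K * u) * (K * 1)).
  exact: is_derive_comp1.
have sT : s <= T by rewrite (le_trans st')// lerDl.
have mono := @derive_ge0_le R _ _ s T sT
  (fun (u : R) su => is_derive_fM (dEE u su) (dexp u)).
have ET : E T = 0.
  have tT : exterior t (T *: th).
    by apply: (exterior_ray (lt_le_trans r0 rt) th1); rewrite ltrDl.
  have z w : partials w f (T *: th) = partials w (fun=> 0) (T *: th).
    by apply: (partials_local w (@exterior_open R t)) tT => v; exact: ft.
  have z1 k : partials [:: k] f (T *: th) = 0.
    by rewrite z; apply: partial_is_derive; exact: is_derive_fcst.
  rewrite /E /h ft// mul0r add0r big1// => j _.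
  by rewrite /y z1 mul0r.
have Es : E s * expR (K * s) <= 0.
  rewrite -[leRHS](mul0r (expR (K * T))) -ET; apply: mono => u su.
  have -> : dE u * expR (K * u) + E u * (expR (K * u) * (K * 1)) =
     expR (K * u) * (dE u + K * E u) by ring.
  rewrite mulr_ge0 ?expR_ge0//.
  apply: (@energy_rate _ _ (\sum_j `|y j u|)) => //.
    apply: le_trans (ler_norm_sum _ _ _) _; apply: ler_sum => k _.
    by rewrite normrM ler_piMl// -th1 coord_le_enorm.
  move=> j; have := @gradient_dot_le R (fun k => partials [:: k; j] f) th (u *: th)
    (G * (\sum_j `|y j u|) + G * `|h u|) 1 _ _.
  rewrite mulr1; apply=> k; first by rewrite -th1 coord_le_enorm.
  have Au := inA _ su; have ru := sub _ Au.
  rewrite (static_linear_hessian ug k j ru (gsym ru) (st ru)).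
  apply: le_trans (ler_normD _ _) _; apply: lerD.
    apply: le_trans (ler_norm_sum _ _ _) _; rewrite mulr_sumr; apply: ler_sum => c _.
    by rewrite normrM ler_wpM2r// HG'.
  by rewrite normrM ler_wpM2r// HP'.
have : E s <= 0 by rewrite -(pmulr_lle0 _ (expR_gt0 (K * s))).
have xs : s *: th = x by exact: ray_dirK.
rewrite /E /h xs => Es0; apply/eqP; rewrite -sqrf_eq0 -normr_le0 ger0_norm ?sqr_ge0//.
apply: le_trans Es0; rewrite expr2 lerDl; apply: sumr_ge0 => j _.
by rewrite -expr2 sqr_ge0.
Qed.

End UniqueContinuation.

(** * Metric and potential in a chart onto an exterior domain *)

Section StaticPotentialInChart.
Context {R : realType} {M : topologicalType} {S : smooth_structure R M}.
Notation V := 'rV[R]_3.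
Variables (g : riemannian_metric S) (E : set M) (f : M -> R).
Hypothesis hf : static_potential g E f.
Variables (c : chart R M) (r : R).
Hypotheses (mc : max_atlas S c) (cE : cdom c `<=` E) (ic : cimage c = exterior r).

Lemma chart_overlap : cmap c @` (cdom c `&` E) = exterior r.
Proof.
rewrite -ic; congr (_ @` _); apply/seteqP; split=> [p []//|p cp].
by split=> //; exact: cE.
Qed.

Lemma metric_smooth a b : smooth_on_open (exterior r) (fun x => gcoef g c x a b).
Proof.
by apply: smooth_on_openE; [exact: exterior_open|rewrite -ic; exact: gcoef_smooth].
Qed.

Lemma metric_unit x : exterior r x -> gcoef g c x \in unitmx.
Proof.
rewrite -ic => cx; rewrite unitmxE unitfE; apply/det0P => -[v v0 vg].
by have := gcoef_pos g mc cx v0; rewrite vg mul0mx mxE ltxx.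
Qed.

Lemma metric_sym x : exterior r x -> (gcoef g c x)^T = gcoef g c x.
Proof. by rewrite -ic; exact: gcoef_sym. Qed.

Lemma potential_smooth : smooth_on_open (exterior r) (f \o cinv c).
Proof.
apply: smooth_on_openE; first exact: exterior_open.
by rewrite -chart_overlap; case: hf => + _ _; apply.
Qed.

Lemma potential_static x : exterior r x -> static_equation_at (gcoef g c) (f \o cinv c) x.
Proof.
move=> rx; case: hf => _ _; apply; first exact: mc.
by rewrite chart_overlap; apply: open_nbhs_nbhs; split=> //; exact: exterior_open.
Qed.

Lemma potential_chart p : cdom c p -> f p = (f \o cinv c) (cmap c p).
Proof. by case: mc => -[_ _ K _ _] _ /K/= ->. Qed.

Lemma exterior_chart p : cdom c p -> exterior r (cmap c p).
Proof. by move=> cp; rewrite -ic; exists p. Qed.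

End StaticPotentialInChart.

Theorem theorem1p1 (R : realType) (M : topologicalType)
    (S : smooth_structure R M) (g : riemannian_metric S)
    (A : asymptotically_flat g) (i : 'I_(nends A)) (m : R)
    (hm : m != 0) (hE : asymptotically_schwarzschild i m)
    (f : M -> R) (hf : static_potential g (the_end i) f) :
  bounded_on_end i f /\
  (outside_compact i (fun p => 0 < f p) \/ outside_compact i (fun p => f p < 0)).
Proof.
have [psi [r [mpsi psiE r0 ipsi tend] bO]] := hE.
pose F := f \o cinv psi.
have sF : smooth_on_open (exterior r) F := potential_smooth hf mpsi psiE ipsi.
have sG a b := metric_smooth g mpsi ipsi a b.
have uG := metric_unit g mpsi ipsi.
(* The radius on which the expansions of the metric are stated. *)
pose r1 := r + 1.
have r11 : 1 <= r1 by rewrite lerDr ltW.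
have sub1 : exterior r1 `<=` (exterior r : set 'rV[R]_3).
  by move=> x; apply: le_lt_trans; rewrite lerDl.
have [rho r1rho [GamL PL]] := curvature_asymptotics r11
  (fun a b => smooth_on_open_sub sub1 (sG a b)) (fun x rx => uG x (sub1 x rx))
  (metric_limit r0 bO) (dmetric_limit r0 sG bO) (ddmetric_limit r0 sG bO).
have sub2 : exterior rho `<=` (exterior r : set 'rV[R]_3).
  by move=> x rx; apply: sub1; exact: le_lt_trans rx.
have lin : linear_hessian rho F (christoffel (gcoef g psi))
    (static_potential_term (gcoef g psi)).
  move=> a b x /sub2 rx; apply: (static_linear_hessian uG a b rx).
    exact: (metric_sym g mpsi ipsi).
  exact: (potential_static hf mpsi psiE ipsi).
have rho1 : 1 <= rho by exact: le_trans r1rho.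
have [s rhos [[b b0 Fb]|F0]] := asymptotic_dichotomy hm rho1
  (smooth_on_open_sub sub2 sF) lin GamL PL; last first.
  (* The point where f is nonzero may lie outside the domain of [psi]. The vanishing near infinity
     is therefore transported to the chart of the end, which covers the whole end, and continued
     inwards there. *)
  case: (hf) => _ [p Ep fp] _; case/negP: fp; apply/eqP.
  have [t Ht] := tend s.
  have mec := end_chart_max i; have iec := end_chart_image i.
  have ecE : cdom (end_chart i) `<=` the_end i by [].
  rewrite (potential_chart f mec Ep).
  apply: (static_potential_unique_continuation (end_radius_gt0 i) (metric_smooth g mec iec)
    (metric_unit g mec iec) (metric_sym g mec iec) (potential_smooth hf mec ecE iec)
    (potential_static hf mec ecE iec) (t := Num.max t (end_radius i))).
  - by rewrite le_max lexx orbT.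
  - move=> x; rewrite /exterior/= gt_max => /andP[tx ex].
    have : cimage (end_chart i) x by rewrite iec.
    move=> [q qE qx]; have tq : t < end_norm i q by rewrite /end_norm qx.
    have [qd qs] := Ht q qE tq.
    rewrite -qx; apply: etrans (esym (potential_chart f mec qE)) _.
    by rewrite (potential_chart f mpsi qd); exact: F0.
  exact: exterior_chart.
have [C C0 HC] := Fb.
(* Convergence of f to [b], restated in terms of the radius in the chart of the end. *)
have far e : 0 < e -> exists t, forall p, the_end i p -> t < end_norm i p -> `|f p - b| <= e.
  move=> e0.
  have [T T0 HT] := @powR_small R (- (1 / 2)) (e / (C + 1)) ltac:(lra)
    ltac:(by rewrite divr_gt0// ltr_wpDl).
  have [t Ht] := tend (Num.max s T); exists t => p pE tp.
  have [pd] := Ht p pE tp; rewrite gt_max => /andP[sp Tp].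
  rewrite (potential_chart f mpsi pd); apply: le_trans (HC _ sp) _.
  apply: le_trans (ler_wpM2l C0 (HT _ (ltW Tp))) _.
  by rewrite mulrCA ger_pMr// ler_pdivrMr ?ltr_wpDl// mul1r lerDl.
have iec := end_chart_image i; have mec := end_chart_max i.
split.
  move=> r' er'; have [t Ht] := far 1 ltr01.
  (* Up to radius [t] compactness gives the bound, since r' exceeds the radius of the removed ball;
     beyond it |f| <= 1 + |b|. *)
  have [|C1 C10 HC1] := @annulus_bounded R r' t (f \o cinv (end_chart i)).
    move=> x /andP[rx _].
    apply: (smooth_continuous (potential_smooth hf mec (fun p pE => pE) iec) (s := [::])).
    exact: lt_le_trans rx.
  exists (C1 + (1 + `|b|)) => p pE rp.
  have [tp|pt] := ltP t (end_norm i p).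
    apply: (@le_trans _ _ (1 + `|b|)); last by rewrite lerDr.
    by rewrite -[f p](subrK b); apply: le_trans (ler_normD _ _) _; rewrite lerD2r Ht.
  rewrite (potential_chart f mec pE); apply: le_trans (HC1 _ _) _.
    by rewrite /annulus/= rp.
  by rewrite lerDl addr_ge0.
(* Within |b| / 2 of the limit, f has the sign of [b]. *)
have [t Ht] := far (`|b| / 2) ltac:(by rewrite divr_gt0// normr_gt0).
have out p : the_end i p -> ~ annulus 0 t (cmap (end_chart i) p) -> `|f p - b| <= `|b| / 2.
  move=> pE pA; apply: Ht => //; rewrite ltNge; apply/negP => pt.
  by apply: pA; rewrite /annulus/= enorm_ge0.
have [bP|bN|b00] := ltgtP 0 b; last by rewrite b00 eqxx in b0.
- left; exists (annulus 0 t); first exact: annulus_compact.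
  move=> p pE pA; have := out p pE pA.
  by rewrite (gtr0_norm bP) ler_norml => /andP[? ?]; lra.
- right; exists (annulus 0 t); first exact: annulus_compact.
  move=> p pE pA; have := out p pE pA.
  by rewrite (ltr0_norm bN) ler_norml => /andP[? ?]; lra.
Qed.
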